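(* Let $n\ge 5$ and let $G\in\mathscr{U}_{n,2}\setminus\{U_{n,2}\}$, i.e. $G$ is an $n$-vertex unicyclic graph with matching number $2$ that is not isomorphic to $U_{n,2}$. If $n=5$, then $\xi^d(G)\ge 60$, with equality if and only if $G\cong C_5$. If $n\ge 6$, then $\xi^d(G)\ge 6n^2-11n-16$, with equality if and only if $G\cong H_{n,4}$.
   Context: All graphs are finite, simple and connected. For a graph $G$ and $v\in V_G$, $d(u,v)$ is the usual graph distance, $\varepsilon_G(v)=\max_{u\in V_G} d(u,v)$ is the eccentricity, and $D_G(v)=\sum_{u\in V_G} d(u,v)$. The eccentric distance sum is $\xi^d(G)=\sum_{v\in V_G}\varepsilon_G(v)D_G(v)$. A unicyclic graph is a connected graph with $|V_G|=|E_G|$. The matching number is the maximum number of pairwise independent edges. $\mathscr{U}_{n,m}$ is the set of unicyclic graphs with $n$ vertices and matching number $m$. $C_k$ is the cycle on $k$ vertices. $U_{n,2}$ is the $n$-vertex graph obtained from a triangle by attaching $n-3$ pendant vertices to one of its vertices. $H_{n,k}$ is the graph obtained from $C_k$ by attaching $n-k$ pendant vertices to one vertex of $C_k$. *)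

(* Defs.v *)
From HB Require Import structures.
From mathcomp Require Import all_boot.
Set Implicit Arguments.
Unset Strict Implicit.
Unset Printing Implicit Defensive.

(** * Finite simple graphs *)

Record sgraph := SGraph {
  vertex :> finType;
  adj : rel vertex;
  adj_sym : symmetric adj;
  adj_irr : irreflexive adj }.

Definition isom (G H : sgraph) : Prop :=
  exists2 f : G -> H,
    bijective f & forall x y : G, adj (f x) (f y) = adj x y.

Definition connected (G : sgraph) : bool :=
  (0 < #|G|) && [forall x : G, forall y : G, connect (@adj G) x y].

Definition edges (G : sgraph) : {set {set G}} :=
  [set E : {set G} | [exists x : G, exists y : G,
     adj x y && (E == [set x; y])]].

Definition unicyclic (G : sgraph) : bool := connected G && (#|G| == #|edges G|).

(** * Matchings *)

Definition matching (G : sgraph) (M : {set {set G}}) : bool :=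
  (M \subset edges G) && trivIset M.

Definition matching_number (G : sgraph) : nat :=
  \max_(M : {set {set G}} | matching M) #|M|.

Definition unicyclic_class (n m : nat) (G : sgraph) : bool :=
  [&& unicyclic G, #|G| == n & matching_number G == m].

(** * Distances and the eccentric distance sum *)

Definition has_walk (G : sgraph) (u v : G) (k : nat) : bool :=
  [exists p : k.-tuple G, path (@adj G) u p && (last u p == v)].

(* The least length of a walk from u to v.  Two vertices joined by a walk are
   joined by one of length < #|G|; the value is #|G| if there is no walk. *)
Definition dist (G : sgraph) (u v : G) : nat :=
  find (has_walk u v) (iota 0 #|G|).

Definition ecc (G : sgraph) (v : G) : nat := \max_(u : G) dist u v.

Definition dist_sum (G : sgraph) (v : G) : nat := \sum_(u : G) dist u v.

Definition ecc_dist_sum (G : sgraph) : nat := \sum_(v : G) ecc v * dist_sum v.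

(** * Cycles and cycles with pendant vertices *)

Definition cycle_adj (k : nat) (i j : 'I_k) : bool :=
  (i != j) && ((j == i.+1 %% k :> nat) || (i == j.+1 %% k :> nat)).

Fact cycle_adj_sym (k : nat) : symmetric (@cycle_adj k).
Proof. by move=> i j; rewrite /cycle_adj eq_sym orbC. Qed.

Fact cycle_adj_irr (k : nat) : irreflexive (@cycle_adj k).
Proof. by move=> i; rewrite /cycle_adj eqxx. Qed.

(* A cycle only for 3 <= k. *)
Definition cycle_graph (k : nat) : sgraph :=
  SGraph (@cycle_adj_sym k) (@cycle_adj_irr k).

Definition pendant_adj (G : sgraph) (v : G) (p : nat) (x y : G + 'I_p) : bool :=
  match x, y with
  | inl a, inl b => adj a b
  | inl a, inr _ => a == v
  | inr _, inl b => b == v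
  | inr _, inr _ => false
  end.

Fact pendant_adj_sym (G : sgraph) (v : G) (p : nat) :
  symmetric (@pendant_adj G v p).
Proof. by case=> [a|i] [b|j] //=; rewrite adj_sym. Qed.

Fact pendant_adj_irr (G : sgraph) (v : G) (p : nat) :
  irreflexive (@pendant_adj G v p).
Proof. by case=> [a|i] //=; rewrite adj_irr. Qed.

(* G with p pendant vertices attached to v. *)
Definition attach_pendants (G : sgraph) (v : G) (p : nat) : sgraph :=
  SGraph (@pendant_adj_sym G v p) (@pendant_adj_irr G v p).

(* H_{n,k}, for 3 <= k <= n; the proof of 0 < k names the vertex 0 of C_k. *)
Definition H_graph (n k : nat) (k_gt0 : 0 < k) : sgraph :=
  @attach_pendants (cycle_graph k) (Ordinal k_gt0) (n - k).

(* U_{n,2}, for 3 <= n. *)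
Definition U2_graph (n : nat) : sgraph :=
  @attach_pendants (cycle_graph 3) (ord0 : 'I_3) (n - 3).

(* Main.v *)
(** If no vertex is adjacent to all others then every eccentricity is at least 2,
    and D(v) >= 2(n-1) - deg v + #{u : d(u,v) >= 3}, with equality when no
    distance from v exceeds 3; a vertex with some u at distance >= 3 has
    eccentricity >= 3.  For n = 5, summing 2(8 - deg v) gives 60, attained exactly
    in diameter 2, which forces 2-regularity and hence C_5.  For n >= 6, a
    connected graph with matching number 2 either has two vertices covering all
    edges, or a vertex v such that all edges avoiding v lie in one triangle.
    Counting n edges then leaves: a universal vertex (G = U_{n,2}); two adjacent
    centres with one common neighbour; two nonadjacent centres with two common
    neighbours, which is H_{n,4} if one centre has no private neighbour; and a
    triangle joined by an edge to the centre of a star.  Summing the bounds gives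
    6n^2 - 11n - 16 for H_{n,4} and a larger value in the other cases. *)
Require Import Defs.
From mathcomp Require Import all_boot.
From mathcomp Require Import zify.

Set Implicit Arguments.
Unset Strict Implicit.
Unset Printing Implicit Defensive.

(** * Neighbourhoods and far vertices *)

Definition nbrs (G : sgraph) (v : G) : {set G} := [set u | adj v u].

(* In a connected graph, the vertices at distance at least 3 from v. *)
Definition far (G : sgraph) (v : G) : {set G} :=
  [set u | [&& u != v, ~~ adj v u & [disjoint nbrs v & nbrs u]]].

Lemma nbrsC (G : sgraph) (u v : G) : (u \in nbrs v) = (v \in nbrs u).
Proof. by rewrite !inE adj_sym. Qed.

Lemma adj_neq (G : sgraph) (u v : G) : adj u v -> u != v.
Proof. by apply: contraTneq => ->; rewrite adj_irr. Qed.

(** * Distances *)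

Lemma dist_le_walk (G : sgraph) (u v : G) (p : seq G) :
  path (@adj G) u p -> last u p = v -> dist u v <= size p.
Proof.
move=> up lp; rewrite /dist; set s := iota _ _.
(* The search runs over lengths below [#|G|] and never returns more than [#|G|], so a longer walk
   bounds it trivially. *)
have [szp|szp] := ltnP (size p) #|G|; last first.
  by apply: leq_trans szp; rewrite (leq_trans (find_size _ _)) // size_iota.
rewrite leqNgt; apply/negP => /(before_find 0).
rewrite nth_iota // => /negbT/existsP[]; exists (in_tuple p).
by rewrite up lp eqxx.
Qed.

Lemma dist_walk (G : sgraph) (u v : G) :
  dist u v < #|G| ->
  exists p, [/\ size p = dist u v, path (@adj G) u p & last u p = v].
Proof.
move=> lt_d; have := lt_d; rewrite -{1}(size_iota 0 #|G|) -has_find.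
move=> /(nth_find 0); rewrite -/(dist u v) nth_iota //.
case/existsP=> p /andP[up /eqP lp].
by exists p; rewrite size_tuple.
Qed.

(** The three indicators test for distance at least 1, 2 and 3. If the distance is at most 2, then
    [3 <= #|G|] keeps it below the default value of [dist], so a walk of that length exists and
    refutes the later tests. *)
Lemma dist_ge (G : sgraph) (u v : G) : 3 <= #|G| ->
  (u != v) + ((u != v) && ~~ adj v u) + (u \in far v) <= dist u v.
Proof.
move=> G3; have [d3|] := leqP 3 (dist u v).
  by apply: leq_trans d3; case: (u != v) (~~ adj v u) (u \in far v) => [] [] [].
rewrite ltnS => d2.
have [p []] := dist_walk (leq_ltn_trans d2 G3).
case: p => [|x [|y [|z p]]] /= dE up ev; rewrite -dE -ev inE.
- by rewrite eqxx.
- by move: up; rewrite andbT adj_sym => ->; rewrite !andbF; case: eqP.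
- case/and3P: up => ux xy _; have -> : [disjoint nbrs y & nbrs u] = false.
    by apply/pred0Pn; exists x; rewrite /= !inE ux adj_sym xy.
  by rewrite !andbF; case: (u != y) (~~ adj y u) => [] [].
- by rewrite -dE in d2.
Qed.

Lemma dist_eq (G : sgraph) (u v : G) : 3 <= #|G| ->
    (u \in far v -> dist u v <= 3) ->
  dist u v = (u != v) + ((u != v) && ~~ adj v u) + (u \in far v).
Proof.
move=> G3 d3; apply/eqP; rewrite eqn_leq dist_ge // andbT.
have [->|uv] := eqVneq u v.
  by rewrite inE eqxx; apply: (@dist_le_walk _ _ _ [::]).
have [vu|vu] := boolP (adj v u).
  by rewrite (leq_trans (@dist_le_walk _ _ _ [:: v] _ _)) //= adj_sym vu.
have [/d3 //|] := boolP (u \in far v).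
rewrite inE uv vu => /pred0Pn[x]; rewrite /= !inE => /andP[vx ux].
by rewrite (@dist_le_walk _ _ _ [:: x; v]) //= ux adj_sym vx.
Qed.

Lemma card_sum_mem (T : finType) (A : {set T}) : #|A| = \sum_(x : T) (x \in A).
Proof. by rewrite -sum1_card big_mkcond; apply: eq_bigr => x _; case: ifP. Qed.

(** Each [u != v] contributes 2 once its adjacency to [v] is added back, and 1 more if it is far. *)
Lemma sum_truncated_dist (G : sgraph) (v : G) :
  \sum_(u : G) ((u != v) + ((u != v) && ~~ adj v u) + (u \in far v)) + #|nbrs v|
  = 2 * #|G|.-1 + #|far v|.
Proof.
have cv : #|G|.-1 = \sum_(u : G) (u != v).
  rewrite -(cardsC1 v) card_sum_mem.
  by apply: eq_bigr => u _; rewrite !inE.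
rewrite mul2n -addnn {1}cv cv !card_sum_mem -!big_split /=.
apply: eq_bigr => u _; rewrite [u \in nbrs v]inE.
have [->|_] := eqVneq u v; first by rewrite adj_irr; lia.
by case: (adj v u); lia.
Qed.

Lemma dist_sum_ge (G : sgraph) (v : G) : 3 <= #|G| ->
  2 * #|G|.-1 + #|far v| <= dist_sum v + #|nbrs v|.
Proof.
move=> G3; rewrite -sum_truncated_dist leq_add2r.
by apply: leq_sum => u _; apply: dist_ge.
Qed.

Lemma dist_sum_eq (G : sgraph) (v : G) : 3 <= #|G| ->
    (forall u, u \in far v -> dist u v <= 3) ->
  dist_sum v + #|nbrs v| = 2 * #|G|.-1 + #|far v|.
Proof.
move=> G3 d3; rewrite -sum_truncated_dist; congr (_ + _).
by apply: eq_bigr => u _; apply: dist_eq => //; apply: d3.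
Qed.

Lemma ecc_ge2 (G : sgraph) (v : G) : 3 <= #|G| ->
  nbrs v != [set~ v] -> 2 <= ecc v.
Proof.
move=> G3; have svC : nbrs v \subset [set~ v].
  by apply/subsetP=> u; rewrite !inE => /adj_neq; rewrite eq_sym.
rewrite eqEsubset svC => /subsetPn[u]; rewrite !inE => uv vu.
apply: leq_trans (leq_bigmax u); apply: leq_trans (dist_ge u v G3).
by rewrite uv vu.
Qed.

Lemma ecc_ge3 (G : sgraph) (v : G) : 3 <= #|G| -> far v != set0 -> 3 <= ecc v.
Proof.
move=> G3 /set0Pn[u uF]; apply: leq_trans (leq_bigmax u).
apply: leq_trans (dist_ge u v G3); rewrite uF.
by move: uF; rewrite inE => /and3P[-> ->].
Qed.

Lemma ecc_dist_ge2 (G : sgraph) (v : G) : 3 <= #|G| -> nbrs v != [set~ v] ->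
  2 * (2 * #|G|.-1 - #|nbrs v|) <= ecc v * dist_sum v.
Proof.
move=> G3 vN; apply: leq_mul; first exact: ecc_ge2.
by have := dist_sum_ge v G3; lia.
Qed.

(** Here [k] is any positive lower bound on the number of far vertices, so it suffices to exhibit
    some of them; a single one already raises the eccentricity to 3. *)
Lemma ecc_dist_ge3 (G : sgraph) (v : G) (k : nat) :
    3 <= #|G| -> 0 < k <= #|far v| ->
  3 * (2 * #|G|.-1 + k - #|nbrs v|) <= ecc v * dist_sum v.
Proof.
move=> G3 /andP[k0 kF]; apply: leq_mul.
  by apply: ecc_ge3 => //; rewrite -card_gt0; lia.
by have := dist_sum_ge v G3; lia.
Qed.

(** The factor [2 + (far v != set0)] is the eccentricity: a non-neighbour gives 2, a far vertex
    gives 3, and the hypothesis on distances forbids more. This evaluates the extremal graphs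
    exactly. *)
Lemma ecc_dist_eq (G : sgraph) (v : G) :
    3 <= #|G| -> nbrs v != [set~ v] ->
    (forall u, u \in far v -> dist u v <= 3) ->
  ecc v * dist_sum v =
  (2 + (far v != set0)) * (2 * #|G|.-1 + #|far v| - #|nbrs v|).
Proof.
move=> G3 vN d3; congr (_ * _); last by have := dist_sum_eq G3 d3; lia.
apply/eqP; rewrite eqn_leq; apply/andP; split.
  apply/bigmax_leqP=> u _; rewrite dist_eq //; last exact: d3.
  have [uF|//] := boolP (u \in far v); last by case: (u != v) (~~ adj v u) => [] [].
  have -> : far v != set0 by apply/set0Pn; exists u.
  by case: (u != v) (~~ adj v u) => [] [].
by case: eqP => [_|/eqP /ecc_ge3]; [apply: ecc_ge2 | apply].
Qed.

(** * Degrees *)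

(** Both sides count ordered adjacent pairs, first by their first vertex, then by the edge they
    span, which arises from exactly two pairs. *)
Lemma handshake (G : sgraph) : \sum_(v : G) #|nbrs v| = 2 * #|edges G|.
Proof.
pose A := [set p : G * G | adj p.1 p.2].
have -> : \sum_(v : G) #|nbrs v| = \sum_(p in A) 1.
  under eq_bigr => v _ do rewrite card_sum_mem.
  rewrite pair_bigA [RHS]big_mkcond; apply: eq_bigr => -[u v] _.
  by rewrite !inE /=; case: (adj u v).
rewrite (partition_big (fun p => [set p.1; p.2]) (mem (edges G))) /=; last first.
  move=> [x y]; rewrite !inE /= => xy.
  by apply/existsP; exists x; apply/existsP; exists y; rewrite xy eqxx.
rewrite mulnC -sum_nat_const; apply: eq_bigr => E.
rewrite inE => /existsP[x /existsP[y /andP[xy /eqP->]]].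
have -> : 2 = #|[set (x, y); (y, x)]|.
  by rewrite cards2 xpair_eqE (negPf (adj_neq xy)).
rewrite -sum1_card; apply: eq_bigl => -[u v]; rewrite !inE /= !xpair_eqE.
apply/idP/idP => [/andP[uv /eqP e]|].
  have := set21 u v; have := set22 u v; rewrite e !inE.
  move: (adj_neq uv) => /[swap] /orP[]/eqP-> /[swap] /orP[]/eqP->;
    by rewrite !eqxx ?orbT.
by case/orP=> /andP[/eqP-> /eqP->]; rewrite ?xy ?eqxx // adj_sym xy setUC eqxx.
Qed.

Lemma connected_deg (G : sgraph) (v : G) :
  connected G -> 1 < #|G| -> 0 < #|nbrs v|.
Proof.
case/andP=> _ /forallP/(_ v)/forallP vc G2.
have /card_gt0P[u]: 0 < #|[set~ v]| by rewrite cardsC1; lia.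
rewrite !inE => uv; have /connectP[[|x p]] := vc u.
  by move=> _ e; rewrite e eqxx in uv.
by case/andP=> vx _ _; apply/card_gt0P; exists x; rewrite inE.
Qed.

(** * Pendant vertices *)

(** Trades a bijection for an induced copy of [K] outside which every vertex is a leaf at the image
    of [v]; the cardinality fixes the number of leaves. *)
Lemma isom_attach_pendants (K G : sgraph) (v : K) (p : nat) :
  isom G (attach_pendants v p) <->
  #|G| = #|K| + p /\ exists g : K -> G,
    [/\ injective g, forall i j, adj (g i) (g j) = adj i j &
        forall x, x \notin codom g -> nbrs x = [set g v]].
Proof.
split.
  case=> f f_bij f_adj; have [h fK hK] := f_bij.
  split; first by rewrite (bij_eq_card f_bij) card_sum card_ord.
  have h_inj := can_inj hK.
  exists (h \o inl); split=> [i j /h_inj[]//|i j|x xN].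
    by rewrite /= -f_adj !hK.
  apply/setP=> y; rewrite !inE -f_adj /= -(inj_eq (can_inj fK)) hK.
  case fx: (f x) => [i|i].
    by case/codomP: xN; exists i; rewrite /= -fx fK.
  by case: (f y).
case=> cG [g [g_inj g_adj g_out]].
(* The complement of the copy has [p] elements; enumerating them extends [g] to a bijection. *)
pose R := ~: [set x in codom g].
have cR : #|R| = p.
  have := cardsC [set x in codom g]; rewrite cG cardsE card_codom //.
  by move/addnI.
pose h (x : K + 'I_p) := match x with
  inl i => g i | inr j => enum_val (cast_ord (esym cR) j) end.
have hR j : h (inr j) \notin codom g.
  by have := enum_valP (cast_ord (esym cR) j); rewrite !inE.
have h_inj : injective h.
  move=> [i|i] [j|j].
  - by move/g_inj ->.
  - by move=> e; have := hR j; rewrite -e => /negP[]; apply: codom_f.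
  - by move=> e; have := hR i; rewrite e => /negP[]; apply: codom_f.
  - by move/enum_val_inj/cast_ord_inj ->.
have h_bij : bijective h.
  by apply: inj_card_bij h_inj _; rewrite card_sum card_ord cG.
have h_adj x y : adj (h x) (h y) = @pendant_adj K v p x y.
  have out z i : adj (h (inr i)) z = (z == g v).
    by have /setP/(_ z) := g_out _ (hR i); rewrite !inE.
  case: x y => [i|i] [j|j].
  - exact: g_adj.
  - by rewrite adj_sym out (inj_eq g_inj).
  - by rewrite out (inj_eq g_inj).
  - by rewrite out; apply: contraNF (hR j) => /eqP->; apply: codom_f.
case: h_bij => f hK fK; exists f; first by exists h.
by move=> x y; rewrite -[in RHS](fK x) -[in RHS](fK y) h_adj.
Qed.

(** Besides the n - 1 edges at [v] there is just one more edge, which closes a triangle with [v];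
    all remaining vertices are leaves. *)
Lemma universal_isom_U2 (n : nat) (G : sgraph) (v : G) :
  unicyclic G -> #|G| = n -> 3 <= n -> nbrs v = [set~ v] -> isom G (U2_graph n).
Proof.
case/andP=> Gc /eqP cE nG n3 vN.
have deg_gt0 (u : G) : 0 < #|nbrs u| by apply: connected_deg; rewrite ?nG; lia.
have adjv u : adj v u = (u != v).
  by move/setP/(_ u): vN; rewrite !inE.
(* The degrees other than that of [v] sum to 2n - (n - 1) = n + 1 over n - 1 vertices, which leaves
   an excess of 2 over all ones. *)
have sum_excess : \sum_(u | u != v) #|nbrs u|.-1 = 2.
  have := handshake G; rewrite -cE (bigD1 v) //= vN cardsC1 !nG.
  have -> : \sum_(u | u != v) #|nbrs u| = \sum_(u | u != v) (#|nbrs u|.-1 + 1).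
    by apply: eq_bigr => u _; rewrite addn1 prednK.
  rewrite big_split /= sum1dep_card.
  have -> : #|[set u | u != v]| = n.-1.
    by rewrite -nG -(cardsC1 v); apply: eq_card => u; rewrite !inE.
  by lia.
have [x xv x2] : exists2 x, x != v & 0 < #|nbrs x|.-1.
  case: (pickP (fun x => (x != v) && (0 < #|nbrs x|.-1))) => [x /andP[]|no].
    by exists x.
  have : \sum_(u | u != v) #|nbrs u|.-1 = 0.
    apply/eqP; rewrite sum_nat_eq0; apply/forallP => u; apply/implyP => uv.
    by have := no u; rewrite uv; lia.
  by rewrite sum_excess.
have [y xy yv] : exists2 y, adj x y & y != v.
  have : 0 < #|nbrs x :\ v|.
    by have := cardsD1 v (nbrs x); rewrite inE adj_sym adjv xv; lia.
  by case/card_gt0P=> y; rewrite !inE => /andP[]; exists y.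
have yx : y != x by rewrite eq_sym adj_neq.
(* The adjacent vertices [x] and [y] each use up one unit of the excess, so nothing is left for
   [u]. *)
have leaf u : u != v -> u != x -> u != y -> nbrs u = [set v].
  move=> uv ux uy; apply/esym/eqP; rewrite eqEcard sub1set nbrsC inE adjv uv /=.
  have y2 : 0 < #|nbrs y|.-1.
    have := subset_leq_card (_ : [set v; x] \subset nbrs y).
    rewrite cards2 eq_sym xv /= => /(_ _) H; have {}H : 2 <= #|nbrs y|.
      by apply: H; rewrite subUset !sub1set !inE adj_sym adjv yv adj_sym.
    by lia.
  move: sum_excess.
  rewrite (bigD1 x) //= (bigD1 y) /=; last by rewrite yv yx.
  rewrite (bigD1 u) /=; last by rewrite uv ux uy.
  by rewrite cards1; lia.
apply/isom_attach_pendants; rewrite card_ord nG; split; first by lia.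
pose t := [tuple v; x; y].
exists (tnth t); split.
- apply/tuple_uniqP; rewrite /= !inE !negb_or.
  by rewrite ![v == _]eq_sym xv yv eq_sym yx.
- move: (adjv x) (adjv y); rewrite xv yv => vx vy.
  case=> [[|[|[|//]]] ?] [[|[|[|//]]] ?]; rewrite !(tnth_nth v) /= ?adj_irr //;
    by rewrite /cycle_adj /= // adj_sym.
- move=> u uN; apply: leaf; apply: contraNneq uN => ->.
  + exact: (codom_f (tnth t) (Ordinal (isT : 0 < 3))).
  + exact: (codom_f (tnth t) (Ordinal (isT : 1 < 3))).
  + exact: (codom_f (tnth t) (Ordinal (isT : 2 < 3))).
Qed.

(** * The structure of graphs with matching number 2 *)

(** Stated through six distinct endpoints, so that configurations are refuted by naming vertices
    instead of handling sets of edges. *)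
Definition no_3matching (G : sgraph) : Prop :=
  forall a b c d e f : G, adj a b -> adj c d -> adj e f ->
    uniq [:: a; b; c; d; e; f] -> False.

Lemma edge_mem (G : sgraph) (a b : G) : adj a b -> [set a; b] \in edges G.
Proof.
by move=> ab; rewrite inE; apply/existsP; exists a; apply/existsP; exists b;
  rewrite ab eqxx.
Qed.

Lemma disjoint_edges (G : sgraph) (a b c d : G) : uniq [:: a; b; c; d] ->
  [disjoint [set a; b] & [set c; d]].
Proof.
rewrite /= !inE !negb_or andbT => /and3P[/and3P[_ ac ad] /andP[bc bd] _].
apply/pred0P => x; rewrite /= !inE.
by apply/negP=> /andP[/orP[]/eqP-> /orP[]]; apply/negP.
Qed.

Lemma matching2_pair (G : sgraph) : matching_number G = 2 ->
  exists a b c d : G, [/\ uniq [:: a; b; c; d], adj a b & adj c d].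
Proof.
rewrite /matching_number => mG.
(* The maximum is attained because the family of matchings is nonempty: it contains the empty
   one. *)
have ex_matching : 0 < #|@matching G|.
  apply/card_gt0P; exists set0; rewrite unfold_in /matching sub0set.
  by apply/trivIsetP=> A B; rewrite inE.
have [M mM cM] := eq_bigmax_cond (fun M : {set {set G}} => #|M|) ex_matching.
have /eqP/cards2P[E [F [EF ME]]] := etrans (esym cM) mG.
move: mM; rewrite unfold_in /matching ME => /andP[/subsetP ME2 /trivIsetP tr].
have := ME2 E (set21 _ _); have := ME2 F (set22 _ _); rewrite !inE.
case/existsP=> c /existsP[d /andP[cd /eqP Fcd]].
case/existsP=> a /existsP[b /andP[ab /eqP Eab]].
exists a, b, c, d; split=> //.
have := tr E F (set21 _ _) (set22 _ _) EF; rewrite Fcd Eab => dis.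
have nX x : x \in [set a; b] -> x \notin [set c; d].
  by move=> xab; rewrite (disjointFr dis xab).
have := nX a (set21 _ _); have := nX b (set22 _ _); rewrite !inE !negb_or.
move=> /andP[bc bd] /andP[ac ad].
by rewrite /= !inE !negb_or (adj_neq ab) (adj_neq cd) ac ad bc bd.
Qed.

Lemma matching2_no3 (G : sgraph) : matching_number G = 2 -> no_3matching G.
Proof.
move=> mG a b c d e f ab cd ef U.
have [dis1 dis2 dis3] : [/\ [disjoint [set a; b] & [set c; d]],
    [disjoint [set a; b] & [set e; f]] & [disjoint [set c; d] & [set e; f]]].
  split; apply: disjoint_edges.
  - exact: (mask_uniq U [:: true; true; true; true]).
  - exact: (mask_uniq U [:: true; true; false; false; true; true]).
  - exact: (mask_uniq U [:: false; false; true; true; true; true]).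
have neq (A B : {set G}) x : x \in A -> [disjoint A & B] -> A != B.
  by move=> xA dis; apply/eqP=> AB; have := disjointFr dis xA; rewrite -AB xA.
have n1 := neq _ _ _ (set21 a b) dis1; have n2 := neq _ _ _ (set21 a b) dis2.
have n3 := neq _ _ _ (set21 c d) dis3.
pose M := [set [set a; b]; [set c; d]; [set e; f]].
suff mM : matching M.
  have : #|M| <= matching_number G by apply: leq_bigmax_cond mM.
  rewrite mG /M.
  by rewrite setUC cardsU1 cards2 n1 !inE ![[set e; f] == _]eq_sym
    (negPf n2) (negPf n3).
apply/andP; split.
  by apply/subsetP=> E; rewrite !in_setU !in_set1 -orbA => /or3P[]/eqP->; apply: edge_mem.
apply/trivIsetP=> E F; rewrite !inE -!orbA.
by move=> /or3P[]/eqP-> /or3P[]/eqP->; rewrite ?eqxx // disjoint_sym.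
Qed.

(* [X] is the set of endpoints of the two matching edges [ab] and [cd]. *)
Definition matching_frame (G : sgraph) (X : {set G}) (a b c d : G) : Prop :=
  [/\ uniq [:: a; b; c; d], adj a b, adj c d &
      forall x, (x \in X) = (x \in [:: a; b; c; d])].

Lemma matching_frame_swap (G : sgraph) (X : {set G}) (a b c d : G) :
  matching_frame X a b c d -> matching_frame X c d a b.
Proof.
case=> U ab cd XE; split=> // [|x].
  by move: U; rewrite -[_ :: _]/([:: a; b] ++ [:: c; d]) uniq_catC.
by rewrite XE -[[:: a, b & _]]/([:: a; b] ++ [:: c; d]) mem_cat orbC -mem_cat.
Qed.

Lemma matching_frame_flip (G : sgraph) (X : {set G}) (a b c d : G) :
  matching_frame X a b c d -> matching_frame X b a c d.
Proof.
case=> U ab cd XE; split=> // [||x]; last by rewrite XE !inE orbCA.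
  have /permPl/perm_uniq <- // := perm_catCA [:: a] [:: b] [:: c; d].
by rewrite adj_sym.
Qed.

Definition covered2 (G : sgraph) : Prop :=
  exists a c : G, a != c /\
    forall x y : G, adj x y -> (x \in [:: a; c]) || (y \in [:: a; c]).

(** The conclusion names [p] only; applied to the reversed edge it also places [q] in the
    triangle. *)
Definition covered_star_triangle (G : sgraph) : Prop :=
  exists v x y z : G,
    [/\ uniq [:: v; x; y; z], adj x y, adj y z, adj z x &
        forall p q : G, adj p q -> p != v -> q != v -> p \in [:: x; y; z]].

Definition has_outside_nbr (G : sgraph) (X : {set G}) (u : G) : bool :=
  [exists s, (s \notin X) && adj u s].

Lemma no_outside_nbr (G : sgraph) (X : {set G}) (u s : G) :
  ~~ has_outside_nbr X u -> adj u s -> s \in X.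
Proof.
move=> /existsPn/(_ s); rewrite negb_and negbK => /orP[//|/negbTE->] //.
Qed.

Ltac uniq_tac :=
  rewrite /= ?inE ?negb_or; repeat (apply/andP; split);
  solve [trivial | rewrite eq_sym; trivial].

(** Unpacks a frame into its two edges and the six inequalities between its vertices, left unnamed
    for [uniq_tac] to find. *)
Ltac frame_tac F :=
  let U := fresh "U" in let XE := fresh "XE" in
  case: (F) => U ? ? XE;
  move: (U); rewrite /= !inE !negb_or andbT =>
    /andP[/and3P[? ? ?] /andP[/andP[? ?] ?]].

Lemma notin_frame (G : sgraph) (X : {set G}) (a b c d s : G) :
  matching_frame X a b c d -> s \notin X ->
  [/\ s != a, s != b, s != c & s != d].
Proof. by case=> _ _ _ ->; rewrite !inE !negb_or => /and4P[]. Qed.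

(** The vertices outside [X] are independent: an edge between two of them would extend [ab] and [cd]
    to three disjoint edges. *)
Lemma frame_indep (G : sgraph) (X : {set G}) (a b c d s t : G) :
  no_3matching G -> matching_frame X a b c d ->
  s \notin X -> adj s t -> t \in X.
Proof.
move=> H F sX st; apply: contraT => tX; frame_tac F.
have [? ? ? ?] := notin_frame F sX; have [? ? ? ?] := notin_frame F tX.
have ? := adj_neq st; exfalso; apply: (H a b c d s t) => //; uniq_tac.
Qed.

(** Only [a] can reach outside [X], so the edges avoiding [a] lie among [b], [c], [d]. Either these
    form a triangle, or [bc] or [bd] is missing and [a] together with [d] or [c] covers
    everything. *)
Lemma cover_if_bcd_inner (G : sgraph) (X : {set G}) (a b c d : G) :
    no_3matching G -> matching_frame X a b c d ->
    ~~ has_outside_nbr X b -> ~~ has_outside_nbr X c -> ~~ has_outside_nbr X d ->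
  covered2 G \/ covered_star_triangle G.
Proof.
move=> H F nb nc nd; frame_tac F.
have inside x y : adj x y -> x != a -> y != a -> x \in [:: b; c; d].
  move=> xy xa ya; have : x \in X.
    apply: contraT => xX; have := frame_indep H F xX xy.
    rewrite XE inE (negPf ya) /= !inE => yE.
    have : x \in X; last by rewrite (negPf xX).
    by case/or3P: yE => /eqP yE; move: xy; rewrite adj_sym yE;
      apply: no_outside_nbr.
  by rewrite XE inE (negPf xa).
have [bc|bc] := boolP (adj b c); last first.
  left; exists a, d; split=> // x y xy; apply: contraT.
  rewrite !inE !negb_or => /andP[/andP[xa xd] /andP[ya yd]].
  have := inside x y xy xa ya; rewrite adj_sym in xy; have := inside y x xy ya xa.
  rewrite !inE (negPf xd) (negPf yd) !orbF.
  case/orP=> /eqP ? /orP[]/eqP ?; subst;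
    by move: xy; rewrite ?adj_irr // ?(negPf bc) // adj_sym (negPf bc).
have [bd|bd] := boolP (adj b d); last first.
  left; exists a, c; split=> // x y xy; apply: contraT.
  rewrite !inE !negb_or => /andP[/andP[xa xd] /andP[ya yd]].
  have := inside x y xy xa ya; rewrite adj_sym in xy; have := inside y x xy ya xa.
  rewrite !inE (negPf xd) (negPf yd) /=.
  case/orP=> /eqP ? /orP[]/eqP ?; subst;
    by move: xy; rewrite ?adj_irr // ?(negPf bd) // adj_sym (negPf bd).
by right; exists a, b, c, d; split=> //; rewrite adj_sym.
Qed.

(** If [bd] is an edge, an outside neighbour of [a] and one of [c] must coincide, which leaves no
    place for a second outside vertex. Otherwise [a] and [c] cover all edges. *)
Lemma cover_if_bd_inner (G : sgraph) (X : {set G}) (a b c d : G) :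
    no_3matching G -> matching_frame X a b c d ->
    (forall s, exists2 u, u \notin X & u != s) ->
    (forall u, exists w : G, adj u w) ->
    ~~ has_outside_nbr X b -> ~~ has_outside_nbr X d ->
  covered2 G \/ covered_star_triangle G.
Proof.
move=> H F more nbr nb nd; frame_tac F.
have [oa|na] := boolP (has_outside_nbr X a); last first.
  by apply: (cover_if_bcd_inner H (matching_frame_swap F)).
have [oc|nc] := boolP (has_outside_nbr X c); last exact: (cover_if_bcd_inner H F).
have [bd|bd] := boolP (adj b d).
  have same s t : s \notin X -> t \notin X -> adj a s -> adj c t -> s = t.
    move=> sX tX as_ ct; apply/eqP; apply: contraT => st; exfalso.
    have [? ? ? ?] := notin_frame F sX; have [? ? ? ?] := notin_frame F tX.
    by apply: (H a s c t b d) => //; uniq_tac.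
  case/existsP: oa => s /andP[sX as_]; case/existsP: oc => t /andP[tX ct].
  (* The second outside vertex [u] has its neighbours in [X], hence is adjacent to [a] or [c], and
     [same] then identifies it with [s]. *)
  have [u uX us] := more s; have [w uw] := nbr u.
  have := frame_indep H F uX uw; rewrite XE !inE adj_sym in uw *.
  case/or4P=> /eqP e; subst w.
  - by have e1 := same _ _ sX tX as_ ct; have e2 := same _ _ uX tX uw ct;
      rewrite e2 -e1 eqxx in us.
  - by have := no_outside_nbr nb uw; rewrite (negPf uX).
  - by have e := same _ _ sX uX as_ uw; rewrite e eqxx in us.
  - by have := no_outside_nbr nd uw; rewrite (negPf uX).
left; exists a, c; split=> // x y xy; apply: contraT.
rewrite !inE !negb_or => /andP[/andP[xa xc] /andP[ya yc]].
have key p q : adj p q -> q != a -> q != c -> p \notin X -> False.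
  move=> pq qa qc pX; have := frame_indep H F pX pq; rewrite adj_sym in pq.
  rewrite XE !inE (negPf qa) (negPf qc) /=.
  by case/orP=> /eqP e; subst q; move: pX; rewrite (no_outside_nbr _ pq).
have xX : x \in X by apply: contraT => /(key x y xy ya yc).
rewrite adj_sym in xy.
have yX : y \in X by apply: contraT => /(key y x xy xa xc).
move: xX yX; rewrite !XE !inE (negPf xa) (negPf xc) (negPf ya) (negPf yc) /=.
case/orP=> /eqP ? /orP[]/eqP ?; subst;
  by move: xy; rewrite ?adj_irr // ?(negPf bd) // adj_sym (negPf bd).
Qed.

(** In the new case [a] and [b] both reach outside. Since [cd] is an edge they share a single
    outside neighbour [s], so [a], [b], [s] form the triangle and [c] is the centre of the star. *)
Lemma cover_if_d_inner (G : sgraph) (X : {set G}) (a b c d : G) :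
    no_3matching G -> matching_frame X a b c d ->
    (forall s, exists2 u, u \notin X & u != s) ->
    (forall u, exists w : G, adj u w) ->
    ~~ has_outside_nbr X d ->
  covered2 G \/ covered_star_triangle G.
Proof.
move=> H F more nbr nd; frame_tac F.
have [oa|na] := boolP (has_outside_nbr X a); last first.
  exact: (cover_if_bd_inner H (matching_frame_flip F)).
have [ob|nb] := boolP (has_outside_nbr X b); last first.
  exact: (cover_if_bd_inner H F).
have same s t : s \notin X -> t \notin X -> adj a s -> adj b t -> s = t.
  move=> sX tX as_ bt; apply/eqP; apply: contraT => st; exfalso.
  have [? ? ? ?] := notin_frame F sX; have [? ? ? ?] := notin_frame F tX.
  by apply: (H a s b t c d) => //; uniq_tac.
case/existsP: oa => s /andP[sX as_]; case/existsP: ob => t /andP[tX bt].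
have e := same _ _ sX tX as_ bt; subst t.
have [u uX us] := more s.
(* This pendant edge at [c] later excludes edges from [d] to [a] or [b], which would complete a
   3-matching with [cu] and the edge from [s] to the remaining one of [a], [b]. *)
have cu : adj c u.
  have [w uw] := nbr u; have := frame_indep H F uX uw.
  rewrite XE !inE; rewrite adj_sym in uw; case/or4P=> /eqP e; subst w => //.
  - by have e := same _ _ uX sX uw bt; rewrite e eqxx in us.
  - by have e := same _ _ sX uX as_ uw; rewrite e eqxx in us.
  - by have := no_outside_nbr nd uw; rewrite (negPf uX).
have [? ? ? ?] := notin_frame F sX; have [? ? ? ?] := notin_frame F uX.
right; exists c, a, b, s; split=> //; [by uniq_tac|by rewrite adj_sym|].
move=> p q pq pc qc; rewrite !inE.
have [pX|pX] := boolP (p \in X); last first.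
  have := frame_indep H F pX pq; rewrite XE !inE (negPf qc) /=.
  rewrite adj_sym in pq; case/or3P=> /eqP e; subst q.
  - by rewrite (same _ _ pX sX pq bt) eqxx !orbT.
  - by rewrite (same _ _ sX pX as_ pq) eqxx !orbT.
  - by have := no_outside_nbr nd pq; rewrite (negPf pX).
move: pX; rewrite XE !inE (negPf pc) /=.
case/or3P=> [->//|->|/eqP e]; first by rewrite orbT.
exfalso; subst p; have := no_outside_nbr nd pq; rewrite XE !inE (negPf qc) /=.
case/or3P=> /eqP e; subst q; last by rewrite adj_irr in pq.
  by apply: (H d a b s c u) => //; uniq_tac.
by apply: (H d b a s c u) => //; uniq_tac.
Qed.

Lemma closed_connected (G : sgraph) (T : {set G}) : connected G ->
    (forall p q, adj p q -> p \in T -> q \in T) ->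
  forall x y, x \in T -> y \in T.
Proof.
case/andP=> _ Gc Tc x y xT.
have /forallP/(_ x)/forallP/(_ y) xy := Gc.
rewrite -(closed_connect _ xy) // => p q pq; apply/idP/idP; apply: Tc => //.
by rewrite adj_sym.
Qed.

(** If some endpoint has no outside neighbour, the symmetries of the frame bring it to position [d].
    If all four have one, the graph consists of two triangles [abs] and [cdt] with no edge between
    them, against connectedness. *)
Lemma no_3matching_cover (G : sgraph) (a b c d : G) :
    connected G -> 6 <= #|G| -> no_3matching G ->
    uniq [:: a; b; c; d] -> adj a b -> adj c d ->
  covered2 G \/ covered_star_triangle G.
Proof.
move=> Gc G6 H U0 ab cd; pose X := [set x in [:: a; b; c; d]].
have F : matching_frame X a b c d by split=> // x; rewrite inE.
have nbr u : exists w : G, adj u w.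
  have /card_gt0P[w] : 0 < #|nbrs u| by apply: connected_deg => //; lia.
  by rewrite inE; exists w.
have more (s : G) : exists2 u, u \notin X & u != s.
  have : 0 < #|~: X :\ s|.
    have := cardsD1 s (~: X); have := cardsC X.
    have -> : #|X| = 4 by rewrite cardsE (card_uniqP _).
    by case: (s \in ~: X); lia.
  by case/card_gt0P=> u; rewrite !in_setD1 in_setC => /andP[us uX]; exists u.
have [od|] := boolP (has_outside_nbr X d); last exact: (cover_if_d_inner H F).
have [oc|] := boolP (has_outside_nbr X c); last first.
  have F' := matching_frame_swap (matching_frame_flip (matching_frame_swap F)).
  exact: (cover_if_d_inner H F').
have [ob|] := boolP (has_outside_nbr X b); last first.
  exact: (cover_if_d_inner H (matching_frame_swap F)).
have [oa|] := boolP (has_outside_nbr X a); last first.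
  exact: (cover_if_d_inner H (matching_frame_swap (matching_frame_flip F))).
exfalso; frame_tac F.
have sameab s t : s \notin X -> t \notin X -> adj a s -> adj b t -> s = t.
  move=> sX tX as_ bt; apply/eqP; apply: contraT => st; exfalso.
  have [? ? ? ?] := notin_frame F sX; have [? ? ? ?] := notin_frame F tX.
  by apply: (H a s b t c d) => //; uniq_tac.
have samecd s t : s \notin X -> t \notin X -> adj c s -> adj d t -> s = t.
  move=> sX tX as_ bt; apply/eqP; apply: contraT => st; exfalso.
  have [? ? ? ?] := notin_frame F sX; have [? ? ? ?] := notin_frame F tX.
  by apply: (H c s d t a b) => //; uniq_tac.
case/existsP: oa => s /andP[sX as_]; case/existsP: ob => s' /andP[s'X bs].
have e := sameab _ _ sX s'X as_ bs; subst s'.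
case/existsP: oc => t /andP[tX ct]; case/existsP: od => t' /andP[t'X dt].
have e := samecd _ _ tX t'X ct dt; subst t'.
have as1 x : x \notin X -> adj a x -> x = s.
  by move=> xX ax; apply: sameab.
have bs1 x : x \notin X -> adj b x -> x = s.
  by move=> xX bx; apply/esym; apply: sameab.
have ct1 x : x \notin X -> adj c x -> x = t.
  by move=> xX cx; apply: samecd.
have dt1 x : x \notin X -> adj d x -> x = t.
  by move=> xX dx; apply/esym; apply: samecd.
have out_st u : u \notin X -> u = s \/ u = t.
  move=> uX; have [w uw] := nbr u; have := frame_indep H F uX uw.
  rewrite XE !inE; rewrite adj_sym in uw.
  by case/or4P=> /eqP e; subst w; auto.
(* At least two vertices lie outside [X] because there are at least six in all. *)
have st : s != t.
  apply/eqP=> e; subst t; have [u uX] := more s.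
  by case: (out_st u uX) => ->; rewrite eqxx.
have [? ? ? ?] := notin_frame F sX; have [? ? ? ?] := notin_frame F tX.
(* An edge leaving [{a, b, s}] would form a 3-matching with one further edge from each triangle, or
   contradict the uniqueness of [t], so this set is closed under adjacency. *)
have := @closed_connected G [set a; b; s] Gc _ a c.
rewrite !inE eqxx /= => /(_ _ isT) cT; have : [|| c == a, c == b | c == s].
  rewrite orbA; apply: cT => p q pq; rewrite !inE -!orbA.
  case/or3P=> /eqP e; subst p.
  - have [qX|/as1 ->] := boolP (q \in X); rewrite ?eqxx ?orbT //.
    move: qX; rewrite XE !inE; case/or4P=> /eqP e; subst q; rewrite ?eqxx ?orbT //; exfalso.
      by apply: (H a c b s d t) => //; uniq_tac.
    by apply: (H a d b s c t) => //; uniq_tac.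
  - have [qX|/bs1 ->] := boolP (q \in X); rewrite ?eqxx ?orbT //.
    move: qX; rewrite XE !inE; case/or4P=> /eqP e; subst q; rewrite ?eqxx ?orbT //; exfalso.
      by apply: (H b c a s d t) => //; uniq_tac.
    by apply: (H b d a s c t) => //; uniq_tac.
  - have := frame_indep H F sX pq; rewrite XE !inE; rewrite adj_sym in pq.
    case/or4P=> /eqP e; subst q; rewrite ?eqxx ?orbT //; exfalso.
      by move/eqP: st; apply; apply: ct1.
    by move/eqP: st; apply; apply: dt1.
by rewrite ![c == _]eq_sym; case/or3P=> /eqP; apply/eqP.
Qed.

(** * Lower bounds *)

Lemma sum_uniq_split (T : finType) (s : seq T) (F : T -> nat) : uniq s ->
  \sum_x F x = \sum_(x <- s) F x + \sum_(x | x \notin s) F x.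
Proof. by move=> s_uniq; rewrite (bigID (mem s)) /= big_uniq. Qed.

Lemma sum_notin_ge (T : finType) (s : seq T) (F : T -> nat) (k : nat) :
    uniq s -> (forall x, x \notin s -> k <= F x) ->
  (#|T| - size s) * k <= \sum_(x | x \notin s) F x.
Proof.
move=> s_uniq kF; have := sum_uniq_split (fun=> 1) s_uniq.
rewrite sum1_card sum1_size => ->; rewrite addKn big_distrl /=.
by apply: leq_sum => x /kF; rewrite mul1n.
Qed.

Lemma sum_notin_eq (T : finType) (s : seq T) (F : T -> nat) (k : nat) :
    uniq s -> (forall x, x \notin s -> F x = k) ->
  \sum_(x | x \notin s) F x = (#|T| - size s) * k.
Proof.
move=> s_uniq kF; have := sum_uniq_split (fun=> 1) s_uniq.
rewrite sum1_card sum1_size => ->; rewrite addKn big_distrl /=.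
by apply: eq_bigr => x /kF; rewrite mul1n.
Qed.

Lemma not_universal (G : sgraph) (v : G) :
  #|nbrs v| < #|G|.-1 -> nbrs v != [set~ v].
Proof. by apply: contraTneq => ->; rewrite cardsC1 ltnn. Qed.

Lemma farC (G : sgraph) (u v : G) : (u \in far v) = (v \in far u).
Proof. by rewrite !inE eq_sym adj_sym disjoint_sym. Qed.

(** A common neighbour of [l] and [u] could only be [v], which is not adjacent to [u]. *)
Lemma far_pendant (G : sgraph) (l v u : G) :
  nbrs l = [set v] -> u != l -> u != v -> ~~ adj v u -> u \in far l.
Proof.
move=> lv ul uv vu; rewrite inE ul lv disjoints1 inE [adj u v]adj_sym vu andbT /=.
by have /setP/(_ u) := lv; rewrite !inE => ->.
Qed.

(** The bounds are 2(n+1) at [v], 2(2n-5) at [x], 3(3n-8) at each of [y], [z], and 3(2n-1) at each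
    of the n-4 leaves. They sum to 6n^2 - 3n - 44, which exceeds 6n^2 - 11n - 16 by 8n - 28. The
    comparison is written additively to avoid truncated subtraction. *)
Lemma star_triangle_bound (n : nat) (G : sgraph) (v x y z : G) :
    #|G| = n -> 5 <= n -> uniq [:: v; x; y; z] ->
    nbrs x = [set v; y; z] -> nbrs y = [set x; z] -> nbrs z = [set x; y] ->
    (forall l, l \notin [:: v; x; y; z] -> nbrs l = [set v]) ->
  6 * n ^ 2 < ecc_dist_sum G + 11 * n + 16.
Proof.
move=> nG n5 U Nx Ny Nz Nl.
have [[vx vy vz] [xy xz] yz] :
    [/\ [/\ v != x, v != y & v != z], (x != y) /\ (x != z) & y != z].
  move: U; rewrite /= !inE !negb_or andbT.
  by move=> /andP[/and3P[-> -> ->] /andP[/andP[-> ->] ->]].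
have L u : u \notin [:: v; x; y; z] ->
    [/\ u != v, u != x, u != y & u != z].
  by rewrite !inE !negb_or => /and4P[].
have cvy : ~~ adj v y.
  by have /setP/(_ v) := Ny; rewrite !inE adj_sym (negPf vx) (negPf vz) => ->.
have cvz : ~~ adj v z.
  by have /setP/(_ v) := Nz; rewrite !inE adj_sym (negPf vx) (negPf vy) => ->.
have cx : #|nbrs x| = 3.
  by rewrite Nx setUC cardsU1 cards2 !inE vy eq_sym (negPf vz) eq_sym (negPf yz).
have cy : #|nbrs y| = 2 by rewrite Ny cards2 xz.
have cz : #|nbrs z| = 2 by rewrite Nz cards2 xy.
have Nv : nbrs v = ~: [set v; y; z].
  apply/setP=> u; rewrite in_setC; have [uL|uL] := boolP (u \notin [:: v; x; y; z]).
    have [uv _ uy uz] := L _ uL; have /setP/(_ v) := Nl _ uL.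
    by rewrite nbrsC => ->; rewrite !inE eqxx (negPf uv) (negPf uy) (negPf uz).
  move: uL; rewrite negbK !inE => /or4P[]/eqP->; rewrite ?adj_irr ?eqxx ?orbT //.
  - have /setP/(_ v) := Nx; rewrite !inE eqxx adj_sym => ->.
    by rewrite [x == v]eq_sym (negPf vx) (negPf xy) (negPf xz).
  - by rewrite (negPf cvy).
  - by rewrite (negPf cvz).
have cv : #|nbrs v| = n - 3.
  have := cardsC (nbrs v); rewrite {2}Nv setCK nG setUC cardsU1 cards2 !inE vy.
  by rewrite ![z == _]eq_sym (negPf vz) (negPf yz); clear -n5; lia.
have cl u : u \notin [:: v; x; y; z] -> #|nbrs u| = 1.
  by move/Nl->; rewrite cards1.
pose R := ~: [set w in [:: v; x; y; z]].
have cR : #|R| = n - 4.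
  have := cardsC [set w in [:: v; x; y; z]].
  by rewrite nG cardsE (card_uniqP _) //= -/R; clear -n5; lia.
(* Leaves reach [y] and [z] only through [v] and [x]; so [y] and [z] have n - 4 far leaves each, and
   every leaf has these two far vertices. *)
have far_leaf t u : t \in [:: y; z] -> u \in R -> t \in far u.
  move=> tyz; rewrite in_setC in_set => uL; have [_ _ uy uz] := L u uL.
  by apply: (far_pendant (Nl _ uL)); move: tyz; rewrite !inE => /orP[]/eqP->;
    rewrite // eq_sym.
have farR t : t \in [:: y; z] -> n - 4 <= #|far t|.
  move=> tyz; rewrite -cR; apply/subset_leq_card/subsetP=> u uR.
  by rewrite farC; apply: far_leaf.
have n3 : 3 <= #|G| by rewrite nG (leq_trans _ n5).
have bv : 2 * (2 * n.-1 - (n - 3)) <= ecc v * dist_sum v.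
  have := @ecc_dist_ge2 G v n3; rewrite cv nG; apply.
  by apply: not_universal; rewrite cv nG; clear -n5; lia.
have bx : 2 * (2 * n.-1 - 3) <= ecc x * dist_sum x.
  have := @ecc_dist_ge2 G x n3; rewrite cx nG; apply.
  by apply: not_universal; rewrite cx nG; clear -n5; lia.
have b_tri t : t \in [:: y; z] -> #|nbrs t| = 2 ->
    3 * (2 * n.-1 + (n - 4) - 2) <= ecc t * dist_sum t.
  move=> tyz ct; have := @ecc_dist_ge3 G t (n - 4) n3; rewrite ct nG; apply.
  by rewrite farR // andbT; clear -n5; lia.
have b_leaf u : u \notin [:: v; x; y; z] ->
    3 * (2 * n.-1 + 2 - 1) <= ecc u * dist_sum u.
  move=> uL; have := @ecc_dist_ge3 G u 2 n3; rewrite cl // nG; apply=> /=.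
  have -> : 2 = #|[set y; z]| by rewrite cards2 yz.
  apply/subset_leq_card/subsetP=> t; rewrite in_set2 => tyz.
  by apply: far_leaf; [rewrite !inE | rewrite in_setC in_set].
have b_leaves := sum_notin_ge U b_leaf; rewrite nG /= in b_leaves.
have [by_ bz] := (b_tri y (mem_head _ _) cy, b_tri z (mem_last y [:: z]) cz).
rewrite /ecc_dist_sum (sum_uniq_split _ U) !big_cons big_nil -mulnn.
move: bv bx by_ bz b_leaves; clear -n5.
move: (ecc v * _) (ecc x * _) (ecc y * _) (ecc z * _) (\sum_(_ | _) _) => A B C D E.
have [k ->] : exists k, n = k + 5 by exists (n - 5); rewrite subnK.
by nia.
Qed.

(** With p and q private leaves at the two centres, the bounds sum to 6n^2 - 17n + 9 + 6pq. As p, q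
    >= 1 give pq >= p + q - 1 = n - 4, this is at least 6n^2 - 11n - 15, one more than the value to
    beat. *)
Lemma adjacent_cover_bound (n : nat) (G : sgraph) (a c b : G) :
    #|G| = n -> 5 <= n -> uniq [:: a; c; b] -> adj a c ->
    nbrs a :|: nbrs c = setT -> nbrs a :&: nbrs c = [set b] ->
    nbrs b = [set a; c] ->
    (forall l, l \notin [:: a; c; b] -> nbrs l \subset [set a; c]) ->
    nbrs a != [set~ a] -> nbrs c != [set~ c] ->
  6 * n ^ 2 < ecc_dist_sum G + 11 * n + 16.
Proof.
move=> nG n5 U ac cov common Nb Nl ua uc.
have [aNc [aNb cNb]] : a != c /\ a != b /\ c != b.
  by move: U; rewrite /= !inE !negb_or andbT => /andP[/andP[-> ->] ->].
have n3 : 3 <= #|G| by rewrite nG (leq_trans _ n5).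
have ab : adj a b by have /setP/(_ b) := common; rewrite !inE eqxx => /andP[].
have cb : adj c b by have /setP/(_ b) := common; rewrite !inE eqxx => /andP[].
have in_or u : adj a u || adj c u by have /setP/(_ u) := cov; rewrite !inE.
have in_both u : adj a u && adj c u = (u == b).
  by have /setP/(_ u) := common; rewrite !inE.
(* The subtracted 2 accounts for the other centre and [b]. *)
pose p := #|nbrs a| - 2; pose q := #|nbrs c| - 2.
have rest (F : G -> nat) :
    \sum_x F x = F a + F c + F b + \sum_(x | x \notin [:: a; c; b]) F x.
  by rewrite (sum_uniq_split _ U) !big_cons big_nil addn0 !addnA.
have cN (v : G) : #|nbrs v| = \sum_x adj v x.
  by rewrite card_sum_mem; apply: eq_bigr => x _; rewrite inE.
have pE : #|nbrs a| = p + 2 /\ \sum_(x | x \notin [:: a; c; b]) adj a x = p.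
  have := cN a; rewrite rest adj_irr ac ab /p => ->; clear; lia.
have qE : #|nbrs c| = q + 2 /\ \sum_(x | x \notin [:: a; c; b]) adj c x = q.
  have := cN c; rewrite rest adj_irr [adj c a]adj_sym ac cb /q => ->; clear; lia.
case: pE => da sa; case: qE => dc sc.
have pq : p + q + 3 = n.
  by have := cardsUI (nbrs a) (nbrs c); rewrite cov common cardsT cards1 da dc nG;
    clear; lia.
have lt_deg (v : G) : nbrs v != [set~ v] -> #|nbrs v| < n.-1.
  move=> uv; rewrite -nG -(cardsC1 v) proper_card // properEneq uv.
  by apply/subsetP=> u; rewrite !inE => /adj_neq; rewrite eq_sym.
(* A centre fails to be universal exactly because the other one has a private leaf. *)
have q0 : 0 < q by have := lt_deg a ua; rewrite da; clear -pq; lia.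
have p0 : 0 < p by have := lt_deg c uc; rewrite dc; clear -pq; lia.
have wa : 2 * (2 * n.-1 - (p + 2)) <= ecc a * dist_sum a.
  by have := ecc_dist_ge2 n3 ua; rewrite da nG.
have wc : 2 * (2 * n.-1 - (q + 2)) <= ecc c * dist_sum c.
  by have := ecc_dist_ge2 n3 uc; rewrite dc nG.
have wb : 2 * (2 * n.-1 - 2) <= ecc b * dist_sum b.
  have db : #|nbrs b| = 2 by rewrite Nb cards2 aNc.
  have := @ecc_dist_ge2 G b n3; rewrite db nG; apply.
  by apply: not_universal; rewrite db nG; clear -n5; lia.
(* The private neighbours of one centre are far from those of the other. *)
have leaf (v w l : G) k : uniq [:: v; w; b] -> l \notin [:: v; w; b] ->
    nbrs l \subset [set v; w] -> (forall u, adj v u && adj w u = (u == b)) ->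
    adj v w -> adj w b -> #|nbrs w| = k + 2 -> 0 < k -> adj v l ->
    3 * (2 * n.-1 - 1) + 3 * k <= ecc l * dist_sum l.
  rewrite /= !inE !negb_or andbT => /andP[/andP[vNw vNb] wNb].
  move=> /and3P[lv lw lb] Ns both vw wb_ dw k0 vl.
  have nwl : ~~ adj w l by have := both l; rewrite vl (negPf lb) /= => ->.
  have Nlv : nbrs l = [set v].
    apply/eqP; rewrite eqEsubset sub1set inE adj_sym vl andbT.
    apply/subsetP=> u ul; have := subsetP Ns _ ul; rewrite !inE.
    by case/orP=> // /eqP uw; move: ul nwl; rewrite uw inE adj_sym => ->.
  have : k <= #|far l|.
    have -> : k = #|nbrs w :\: [set v; b]|.
      rewrite cardsD (setIidPr _) ?dw ?cards2 ?vNb ?addnK //.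
      by apply/subsetP=> u; rewrite !inE => /orP[]/eqP-> //; rewrite adj_sym.
    apply/subset_leq_card/subsetP=> u; rewrite !inE negb_or -andbA.
    case/and3P=> uv ub wu; have nvu : ~~ adj v u.
      by have := both u; rewrite wu (negPf ub) andbT => ->.
    have := far_pendant Nlv _ uv nvu; rewrite !inE; apply.
    by apply: contraNneq nwl => <-.
  move=> kF; have := @ecc_dist_ge3 G l k n3; rewrite k0 kF Nlv cards1 nG => /(_ isT).
  by clear -n5; lia.
(* Exactly one of the two adjacency indicators is 1, so a single formula serves both kinds of
   leaves; summing it yields the term 6pq. *)
have wl l : l \notin [:: a; c; b] ->
    3 * (2 * n.-1 - 1) + (3 * q * adj a l + 3 * p * adj c l)
    <= ecc l * dist_sum l.
  move=> lN; have Nsub := Nl l lN; have l_both := in_both l.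
  have lb : (l == b) = false by move: lN; rewrite !inE !negb_or => /and3P[_ _ /negPf].
  move: l_both; rewrite lb; have := in_or l.
  have [al _ /= ->|_ /= cl _] := boolP (adj a l).
    rewrite muln0 addn0 muln1; apply: (@leaf a c) => //.
  rewrite cl muln0 add0n muln1; apply: (@leaf c a) => //.
  - by rewrite /= !inE !negb_or [c == a]eq_sym aNc cNb aNb.
  - by move: lN; rewrite !inE !negb_or => /and3P[-> -> ->].
  - by rewrite setUC.
  - by move=> u; rewrite andbC.
  - by rewrite adj_sym.
have : \sum_(x | x \notin [:: a; c; b])
    (3 * (2 * n.-1 - 1) + (3 * q * adj a x + 3 * p * adj c x))
    <= \sum_(x | x \notin [:: a; c; b]) ecc x * dist_sum x.
  by apply: leq_sum => x; apply: wl.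
rewrite big_split (sum_notin_eq U (fun _ _ => erefl)) nG big_split /=.
rewrite -!big_distrr /= sa sc.
rewrite /ecc_dist_sum rest -mulnn.
move: wa wb wc p0 q0 pq; clear.
move: (ecc a * _) (ecc b * _) (ecc c * _) (\sum_(_ | _) _) => A B C D.
move: p q => p q wa wb wc p0 q0 pq wd.
(* After shifting p and q by one, pq >= p + q - 1 becomes nonnegativity of the product of [p'] and
   [q']. *)
have {p0} [p' pE] : exists p', p = p' + 1 by exists (p - 1); lia.
have {q0} [q' qE] : exists q', q = q' + 1 by exists (q - 1); lia.
subst p q n.
have e1 : (p' + 1 + (q' + 1) + 3).-1 = p' + q' + 4 by lia.
have e2 : (p' + 1 + (q' + 1) + 3 - 3) = p' + q' + 2 by lia.
have e3 : 2 * (p' + q' + 4) - 1 = 2 * p' + 2 * q' + 7 by lia.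
rewrite e1 e2 e3 in wa wb wc wd.
have {}wa : 2 * (p' + 2 * q' + 5) <= A by lia.
have {}wc : 2 * (2 * p' + q' + 5) <= C by lia.
have {}wb : 2 * (2 * p' + 2 * q' + 6) <= B by lia.
clear e1 e2 e3.
lia.
Qed.

Lemma private_leaf (G : sgraph) (v w l : G) :
    nbrs l \subset [set v; w] -> adj v l -> ~~ adj w l ->
  nbrs l = [set v].
Proof.
move=> Ns vl wl; apply/eqP; rewrite eqEsubset sub1set inE adj_sym vl andbT.
apply/subsetP=> u ul; have := subsetP Ns _ ul; rewrite !inE.
by case/orP=> // /eqP uw; move: ul wl; rewrite uw inE adj_sym => ->.
Qed.

(** The centres have p + 1 and q + 1 private leaves, with p + q + 6 = n, and each centre is far from
    the private leaves of the other. In the sum p and q cancel, leaving 6n^2 - 10n - 16, which is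
    larger by n; one far vertex per leaf is enough. *)
Lemma nonadjacent_cover_bound (n : nat) (G : sgraph) (a c b d : G) :
    #|G| = n -> uniq [:: a; c; b; d] -> ~~ adj a c ->
    nbrs a :|: nbrs c = ~: [set a; c] -> nbrs a :&: nbrs c = [set b; d] ->
    nbrs b = [set a; c] -> nbrs d = [set a; c] ->
    (forall l, l \notin [:: a; c; b; d] -> nbrs l \subset [set a; c]) ->
    2 < #|nbrs a| -> 2 < #|nbrs c| ->
  6 * n ^ 2 < ecc_dist_sum G + 11 * n + 16.
Proof.
move=> nG U ac cov common Nb Nd Nl p0 q0.
have [aNc bNd] : a != c /\ b != d.
  by move: U; rewrite /= !inE !negb_or => /and4P[/andP[-> _] _ -> _].
have in_both u : adj a u && adj c u = (u \in [set b; d]).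
  by have /setP/(_ u) := common; rewrite !inE.
have in_or (u : G) : u != a -> u != c -> adj a u || adj c u.
  by have /setP/(_ u) := cov; rewrite !inE negb_or => -> -> ->.
have [p da] : exists p, #|nbrs a| = p + 3 by exists (#|nbrs a| - 3); rewrite subnK.
have [q dc] : exists q, #|nbrs c| = q + 3 by exists (#|nbrs c| - 3); rewrite subnK.
have pq : p + q + 6 = n.
  have := cardsUI (nbrs a) (nbrs c); rewrite cov common cards2 bNd da dc.
  by have := cardsC [set a; c]; rewrite cards2 aNc nG; clear; lia.
have n3 : 3 <= #|G| by rewrite nG -pq; clear; lia.
have leaf (v w l : G) : l \notin [:: a; c; b; d] -> nbrs l \subset [set v; w] ->
    ~~ adj v w -> v != w -> adj v l -> ~~ adj w l ->
    w \in far l.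
  move=> lN Ns vw vNw vl wl; apply: (far_pendant (private_leaf Ns vl wl)) => //.
    by apply: contraNneq vw => ->.
  by rewrite eq_sym.
(* The neighbours of [w] other than the two common ones are leaves, all far from [v]. *)
have hub (v w : G) : v \in [set a; c] -> [set v; w] = [set a; c] -> ~~ adj v w -> v != w ->
    (forall u, adj v u && adj w u = (u \in [set b; d])) ->
    #|nbrs w| - 2 <= #|far v|.
  move=> vac vwE vw vNw both.
  have -> : #|nbrs w| - 2 = #|nbrs w :\: nbrs v|.
    rewrite cardsD; congr (_ - _).
    have -> : nbrs w :&: nbrs v = [set b; d].
      by apply/setP=> u; rewrite -both !inE andbC.
    by rewrite cards2 bNd.
  apply/subset_leq_card/subsetP=> u; rewrite !in_setD ![_ \in nbrs _]inE => /andP[vu wu].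
  have uac : u \notin [set a; c].
    rewrite -vwE !inE negb_or (eq_sym u w) (adj_neq wu) andbT.
    by apply: contraNneq vw => <-; rewrite adj_sym.
  have ubd : u \notin [set b; d] by rewrite -both (negPf vu).
  have uN : u \notin [:: a; c; b; d].
    by move: uac ubd; rewrite !inE !negb_or => /andP[-> ->] /andP[-> ->].
  rewrite farC; apply: (@leaf w v) => //.
  - by rewrite setUC vwE Nl.
  - by rewrite adj_sym.
  - by rewrite eq_sym.
have wa : 3 * (2 * n.-1 + (q + 1) - (p + 3)) <= ecc a * dist_sum a.
  have := @ecc_dist_ge3 G a (q + 1) n3; rewrite da nG; apply; rewrite addn1 /=.
  have := @hub a c (set21 _ _) erefl ac aNc in_both; rewrite dc.
  by clear; lia.
have wc : 3 * (2 * n.-1 + (p + 1) - (q + 3)) <= ecc c * dist_sum c.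
  have := @ecc_dist_ge3 G c (p + 1) n3; rewrite dc nG; apply; rewrite addn1 /=.
  have := @hub c a (set22 _ _) (setUC _ _); rewrite adj_sym eq_sym da.
  move=> /(_ ac aNc) h; have {h} : p + 3 - 2 <= #|far c|.
    by apply: h => u; rewrite andbC.
  by clear; lia.
have wmid (v : G) : nbrs v = [set a; c] -> 2 * (2 * n.-1 - 2) <= ecc v * dist_sum v.
  move=> Nv; have dv : #|nbrs v| = 2 by rewrite Nv cards2 aNc.
  have := @ecc_dist_ge2 G v n3; rewrite dv nG; apply.
  by apply: not_universal; rewrite dv nG -pq; clear; lia.
have wl (l : G) : l \notin [:: a; c; b; d] -> 3 * (2 * n.-1) <= ecc l * dist_sum l.
  move=> lN; have [la lc] : l != a /\ l != c.
    by move: lN; rewrite !inE !negb_or => /and4P[].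
  have nboth : adj a l && adj c l = false.
    by rewrite in_both; apply: contraNF lN; rewrite !inE => /orP[] ->; rewrite ?orbT.
  have [dl fl] : #|nbrs l| = 1 /\ 0 < #|far l|.
    case/orP: (in_or l la lc) => vl.
      have nl : ~~ adj c l by move: nboth; rewrite vl /= => ->.
      split; first by rewrite (private_leaf (Nl l lN)) // cards1.
      by apply/card_gt0P; exists c; apply: (@leaf a) => //; apply: Nl.
    have nl : ~~ adj a l by move: nboth; rewrite vl andbT => ->.
    have Ns : nbrs l \subset [set c; a] by rewrite setUC; apply: Nl.
    split; first by rewrite (private_leaf Ns) // cards1.
    by apply/card_gt0P; exists a; apply: (@leaf c) => //; rewrite 1?adj_sym 1?eq_sym.
  by have := @ecc_dist_ge3 G l 1 n3; rewrite dl addnK nG; apply.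
have := sum_notin_ge U wl; rewrite nG /=.
rewrite /ecc_dist_sum (sum_uniq_split _ U) !big_cons big_nil -mulnn.
move: wa wc (wmid b Nb) (wmid d Nd); rewrite -pq; clear.
move: (ecc a * _) (ecc b * _) (ecc c * _) (ecc d * _) (\sum_(_ | _) _) => A B C D E.
have -> : (p + q + 6).-1 = p + q + 5 by lia.
have -> : p + q + 6 - 4 = p + q + 2 by lia.
have -> : 2 * (p + q + 5) + (q + 1) - (p + 3) = p + 3 * q + 8 by lia.
have -> : 2 * (p + q + 5) + (p + 1) - (q + 3) = 3 * p + q + 8 by lia.
by lia.
Qed.

(** * The extremal graphs *)

(** The graph H_{n,4} described by neighbourhoods, with [a] as the vertex carrying the leaves; the
    neighbourhood of [a] follows by symmetry of adjacency. *)
Definition pendant_C4 (G : sgraph) (a b c d : G) : Prop :=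
  [/\ uniq [:: a; b; c; d],
      nbrs b = [set a; c], nbrs d = [set a; c], nbrs c = [set b; d] &
      forall l, l \notin [:: a; b; c; d] -> nbrs l = [set a]].

Lemma nbrs_in (G : sgraph) (v u : G) (A : {set G}) :
  nbrs v = A -> adj v u = (u \in A).
Proof. by move=> <-; rewrite inE. Qed.

Lemma pendant_C4_isom (n : nat) (G : sgraph) : #|G| = n -> 4 <= n ->
  isom G (@H_graph n 4 isT) <-> exists a b c d : G, pendant_C4 a b c d.
Proof.
move=> nG n4; split.
  move/isom_attach_pendants => [_ [g [g_inj g_adj g_out]]].
  pose o i (i4 : i < 4) : cycle_graph 4 := Ordinal i4.
  have g_eq i i4 j j4 : (g (@o i i4) == g (@o j j4)) = (i == j).
    by rewrite (inj_eq g_inj).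
  pose a := g (@o 0 isT); pose b := g (@o 1 isT).
  pose c := g (@o 2 isT); pose d := g (@o 3 isT).
  have notin x : (x \notin [:: a; b; c; d]) -> x \notin codom g.
    apply: contra => /codomP[[[|[|[|[|//]]]] i4] ->];
      by rewrite !inE !(inj_eq g_inj) ?orbT.
  have g0 : g (Ordinal (isT : 0 < 4)) = a by [].
  (* For a vertex other than [a], adjacency need only be checked on the 4-cycle, since all remaining
     vertices meet only [a]. *)
  have core (v : G) (s : seq G) :
      (forall l, l \notin [:: a; b; c; d] -> v != a) ->
      (forall u, u \in [:: a; b; c; d] -> adj v u = (u \in [set x in s])) ->
      {subset s <= [:: a; b; c; d]} -> nbrs v = [set x in s].
    move=> va vs ss; apply/setP=> u; rewrite [LHS]inE.
    have [/vs //|uN] := boolP (u \in [:: a; b; c; d]).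
    rewrite adj_sym (nbrs_in _ (g_out u (notin u uN))) g0 inE.
    rewrite (negPf (va u uN));
apply/esym; rewrite inE; apply: contraNF uN.
    exact: ss.
  have set2E (x y : G) : [set x; y] = [set z in [:: x; y]].
    by apply/setP=> z; rewrite !inE.
  exists a, b, c, d; split.
  - by rewrite /= !inE !g_eq.
  - rewrite set2E; apply: core => [l _|u|u]; rewrite ?g_eq // !inE.
      by case/or4P=> /eqP->; rewrite g_adj !g_eq.
    by case/orP=> /eqP->; rewrite eqxx ?orbT.
  - rewrite set2E; apply: core => [l _|u|u]; rewrite ?g_eq // !inE.
      by case/or4P=> /eqP->; rewrite g_adj !g_eq.
    by case/orP=> /eqP->; rewrite eqxx ?orbT.
  - rewrite set2E; apply: core => [l _|u|u]; rewrite ?g_eq // !inE.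
      by case/or4P=> /eqP->; rewrite g_adj !g_eq.
    by case/orP=> /eqP->; rewrite eqxx ?orbT.
  - by move=> l /notin /g_out.
case=> a [b [c [d [U Nb Nd Nc Nl]]]].
apply/isom_attach_pendants; rewrite card_ord nG; split; first by rewrite subnKC.
pose t := [tuple a; b; c; d]; exists (tnth t); split.
- exact/tuple_uniqP.
- move: (U); rewrite /= !inE !negb_or andbT => /andP[/and3P[ab ac ad] /andP[/andP[bc bd] cd]].
  have neg (x y : G) : x != y -> (x == y = false) * (y == x = false).
    by move=> xy; rewrite [y == x]eq_sym (negPf xy).
  have E := (neg _ _ ab, neg _ _ ac, neg _ _ ad, neg _ _ bc, neg _ _ bd, neg _ _ cd).
  case=> [[|[|[|[|//]]]] ?] [[|[|[|[|//]]]] ?]; rewrite !(tnth_nth a) /= ?adj_irr //;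
    rewrite /cycle_adj /= ?(nbrs_in _ Nb) ?(nbrs_in _ Nc) ?(nbrs_in _ Nd);
    rewrite ?inE ?eqxx ?orbT ?E //;
    by rewrite adj_sym ?(nbrs_in _ Nb) ?(nbrs_in _ Nc) ?(nbrs_in _ Nd) ?inE ?eqxx ?orbT ?E.
- move=> u uN; rewrite Nl //; apply: contra uN; rewrite !inE.
  case/or4P=> /eqP->.
  + exact: (codom_f (tnth t) (Ordinal (isT : 0 < 4))).
  + exact: (codom_f (tnth t) (Ordinal (isT : 1 < 4))).
  + exact: (codom_f (tnth t) (Ordinal (isT : 2 < 4))).
  + exact: (codom_f (tnth t) (Ordinal (isT : 3 < 4))).
Qed.

(** No distance exceeds 3, so the bounds are exact: 2n at [a], 2(2n-4) at [b] and [d], 3(3n-8) at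
    [c], and 6(n-1) at each of the n-4 leaves. *)
Lemma pendant_C4_value (n : nat) (G : sgraph) (a b c d : G) :
    #|G| = n -> 5 <= n -> pendant_C4 a b c d ->
  ecc_dist_sum G + 11 * n + 16 = 6 * n ^ 2.
Proof.
move=> nG n5 [U Nb Nd Nc Nl].
have n3 : 3 <= #|G| by rewrite nG (leq_trans _ n5).
move: (U); rewrite /= !inE !negb_or andbT => /andP[/and3P[ab ac ad] /andP[/andP[bc bd] cd]].
have L u : u \notin [:: a; b; c; d] -> [/\ u != a, u != b, u != c & u != d].
  by rewrite !inE !negb_or => /and4P[].
have nac : ~~ adj a c.
  by rewrite adj_sym (nbrs_in _ Nc) !inE negb_or ab ad.
have adj_ba : adj b a by rewrite (nbrs_in _ Nb) !inE eqxx.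
have adj_bc : adj b c by rewrite (nbrs_in _ Nb) !inE eqxx orbT.
have adj_da : adj d a by rewrite (nbrs_in _ Nd) !inE eqxx.
have adj_dc : adj d c by rewrite (nbrs_in _ Nd) !inE eqxx orbT.
have adj_la l : l \notin [:: a; b; c; d] -> adj l a.
  by move=> lN; rewrite (nbrs_in _ (Nl l lN)) !inE eqxx.
have adj_a (u : G) : u != a -> u != c -> adj u a.
  move=> ua uc; have [uN|/adj_la //] := boolP (u \in [:: a; b; c; d]).
  by move: uN; rewrite !inE (negPf ua) (negPf uc) /= => /orP[]/eqP->.
have Na : nbrs a = ~: [set a; c].
  apply/setP=> u; rewrite !inE negb_or adj_sym.
  have [->|ua] := eqVneq u a; first by rewrite adj_irr.
  have [->|uc] := eqVneq u c; first by rewrite adj_sym (negPf nac).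
  exact: adj_a.
have da : #|nbrs a| = n - 2.
  by have := cardsC [set a; c]; rewrite -Na cards2 ac nG; clear; lia.
have far_common (v u w : G) : adj v w -> adj u w -> u \notin far v.
  move=> vw uw; rewrite inE !negb_and; apply/orP; right; apply/orP; right.
  by apply/pred0Pn; exists w; rewrite /= !inE vw uw.
have far_hub (v : G) : adj v a -> far v \subset [set c].
  move=> va; apply/subsetP=> u uF; rewrite inE; apply: contraTT uF => uc.
  have [->|ua] := eqVneq u a; first by rewrite inE va andbF.
  exact: (far_common _ _ a va (adj_a u ua uc)).
have no_c (v : G) : adj v c -> c \notin far v.
  by move=> vc; rewrite inE vc andbF.
have fb (v : G) : adj v a -> adj v c -> far v = set0.
  move=> va vc; apply/eqP; rewrite -subset0; apply/subsetP=> u uF.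
  by have := subsetP (far_hub v va) u uF; rewrite inE => /eqP e;
    have := no_c v vc; rewrite -e uF.
have fa : far a = set0.
  apply/eqP; rewrite -subset0; apply/subsetP=> u uF.
  have [ua nau] : u != a /\ ~~ adj a u by move: uF; rewrite inE => /and3P[].
  have uc : u = c.
    by apply/eqP; apply: contraNT nau => uc; rewrite adj_sym adj_a.
  by have := far_common a u b; rewrite uF uc adj_sym adj_ba adj_sym adj_bc => /(_ isT isT).
have fl l : l \notin [:: a; b; c; d] -> far l = [set c].
  move=> lN; apply/eqP; rewrite eqEsubset far_hub ?adj_la // sub1set.
  have [_ _ lc _] := L l lN.
  by apply: (far_pendant (Nl l lN)); rewrite // eq_sym.
have fc : far c = ~: [set x in [:: a; b; c; d]].
  apply/setP=> u; rewrite in_setC in_set; have [uN|uN] := boolP (u \in [:: a; b; c; d]).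
    apply/negbTE; move: uN; rewrite !in_cons orbF => /or4P[]/eqP->.
    - by apply: (far_common c a b); rewrite adj_sym.
    - by rewrite farC; apply: no_c.
    - by rewrite inE eqxx.
    - by rewrite farC; apply: no_c.
  by rewrite farC fl // inE eqxx.
have cfc : #|far c| = n - 4.
  have := cardsC [set x in [:: a; b; c; d]].
  by rewrite -fc cardsE (card_uniqP _) // nG /=; clear -n5; lia.
(* The walk from a leaf through [a] and [b] to [c] has length 3. *)
have dist3 l : l \notin [:: a; b; c; d] -> dist l c <= 3 /\ dist c l <= 3.
  move=> lN; have la := adj_la l lN; split.
    apply: (@dist_le_walk _ _ _ [:: a; b; c]) => //=.
    by rewrite la adj_sym adj_ba adj_bc.
  apply: (@dist_le_walk _ _ _ [:: b; a; l]) => //=.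
  by rewrite adj_sym adj_bc adj_ba adj_sym la.
have wa : ecc a * dist_sum a = 2 * (2 * n.-1 - (n - 2)).
  rewrite ecc_dist_eq // ?fa; last by move=> u; rewrite inE.
    by rewrite eqxx cards0 da nG !addn0.
  by apply: not_universal; rewrite da nG; clear -n5; lia.
have wbd (v : G) : nbrs v = [set a; c] -> ecc v * dist_sum v = 2 * (2 * n.-1 - 2).
  move=> Nv; have dv : #|nbrs v| = 2 by rewrite Nv cards2 ac.
  have fv : far v = set0 by apply: fb; rewrite (nbrs_in _ Nv) !inE eqxx ?orbT.
  rewrite ecc_dist_eq // ?fv; last by move=> u; rewrite inE.
    by rewrite eqxx cards0 dv nG !addn0.
  by apply: not_universal; rewrite dv nG; clear -n5; lia.
have wc : ecc c * dist_sum c = 3 * (2 * n.-1 + (n - 4) - 2).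
  have dc : #|nbrs c| = 2 by rewrite Nc cards2 bd.
  rewrite ecc_dist_eq //.
  - have -> : far c != set0 by rewrite -card_gt0 cfc; clear -n5; lia.
    by rewrite cfc dc nG.
  - by apply: not_universal; rewrite dc nG; clear -n5; lia.
  - by move=> u; rewrite fc in_setC in_set => /dist3[].
have wl l : l \notin [:: a; b; c; d] -> ecc l * dist_sum l = 3 * (2 * n.-1).
  move=> lN; have dl : #|nbrs l| = 1 by rewrite (Nl l lN) cards1.
  rewrite ecc_dist_eq //.
  - have -> : far l != set0 by apply/set0Pn; exists c; rewrite fl // inE.
    by rewrite fl // cards1 dl nG addnK.
  - by apply: not_universal; rewrite dl nG; clear -n5; lia.
  - by move=> u; rewrite fl // inE => /eqP->; have [] := dist3 l lN.
rewrite /ecc_dist_sum (sum_uniq_split _ U) (sum_notin_eq U wl) !big_cons big_nil.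
rewrite wa (wbd b Nb) (wbd d Nd) wc nG /= -mulnn; clear -n5.
have [k ->] : exists k, n = k + 5 by exists (n - 5); rewrite subnK.
have -> : (k + 5).-1 = k + 4 by lia.
have -> : k + 5 - 4 = k + 1 by lia.
by lia.
Qed.

(** * From covers to the extremal alternatives *)

Lemma card_nbrs (G : sgraph) (v : G) : #|nbrs v| = \sum_x adj v x.
Proof. by rewrite card_sum_mem; apply: eq_bigr => x _; rewrite inE. Qed.

(** A centre [c] of degree at most 2 sees only [b] and [d], so every other vertex is a leaf at
    [a]. *)
Lemma private_pendant_C4 (G : sgraph) (a b c d : G) :
    uniq [:: a; b; c; d] ->
    nbrs a :|: nbrs c = ~: [set a; c] -> nbrs a :&: nbrs c = [set b; d] ->
    (forall l, l \notin [:: a; c] -> nbrs l \subset [set a; c]) ->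
    #|nbrs c| <= 2 ->
  pendant_C4 a b c d.
Proof.
move=> U cov common Nl c2.
move: (U); rewrite /= !inE !negb_or andbT => /andP[/and3P[ab ac ad] /andP[/andP[bc bd] cd]].
have in_both u : adj a u && adj c u = (u \in [set b; d]).
  by have /setP/(_ u) := common; rewrite !inE.
have Nc : nbrs c = [set b; d].
  by apply/esym/eqP; rewrite -common eqEcard subsetIr common cards2 bd.
have mid u : u \in [set b; d] -> u \notin [:: a; c] -> nbrs u = [set a; c].
  move=> ubd uN; apply/eqP; rewrite eqEsubset Nl // subUset !sub1set.
  by move: ubd; rewrite -in_both !inE ![adj u _]adj_sym.
split=> // [||l lN].
- by apply: mid; rewrite ?set21 // !inE negb_or eq_sym ab.
- by apply: mid; rewrite ?set22 // !inE negb_or eq_sym ad eq_sym.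
- have [la lb lc ld] : [/\ l != a, l != b, l != c & l != d].
    by move: lN; rewrite !inE !negb_or => /and4P[].
  have ncl : ~~ adj c l by rewrite (nbrs_in _ Nc) !inE negb_or lb.
  apply: (private_leaf (w := c)) => //; first by apply: Nl; rewrite !inE negb_or la.
  have /setP/(_ l) := cov; rewrite !inE (negPf ncl) orbF => ->.
  by rewrite negb_or la.
Qed.

(** Counting n edges fixes the degree sum of the centres, and inclusion-exclusion then gives one
    common neighbour if they are adjacent and two if not. *)
Lemma covered2_cases (n : nat) (G : sgraph) :
    unicyclic G -> #|G| = n -> 5 <= n -> covered2 G ->
  [\/ exists v : G, nbrs v = [set~ v], exists a b c d : G, pendant_C4 a b c d
    | 6 * n ^ 2 < ecc_dist_sum G + 11 * n + 16].
Proof.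
case/andP=> Gc /eqP cE nG n5 [a [c [aNc cover]]].
have U : uniq [:: a; c] by rewrite /= inE aNc.
have Nl l : l \notin [:: a; c] -> nbrs l \subset [set a; c].
  move=> lN; apply/subsetP=> u; rewrite inE => lu.
  by have := cover _ _ lu; rewrite (negPf lN) !inE.
have rest (F : G -> nat) :
    \sum_x F x = F a + F c + \sum_(x | x \notin [:: a; c]) F x.
  by rewrite (sum_uniq_split _ U) !big_cons big_nil addn0.
have deg_l l : l \notin [:: a; c] -> #|nbrs l| = adj a l + adj c l.
  move=> lN; rewrite card_nbrs rest big1 ?addn0 1?[adj l a]adj_sym 1?[adj l c]adj_sym //.
  move=> u uN; apply/eqP; rewrite eqb0; apply: contra uN => lu.
  by have := cover _ _ lu; rewrite (negPf lN).
(* Vertices off the cover send all their edges to [a] and [c], so the degree sum 2n counts every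
   edge at the centres twice, the edge [ac] included. *)
have degs : #|nbrs a| + #|nbrs c| = n + adj a c.
  have := handshake G; rewrite -cE nG rest (eq_bigr _ deg_l) big_split /=.
  have := card_nbrs a; have := card_nbrs c; rewrite !rest !adj_irr [adj c a]adj_sym.
  set A := \sum_(x | _) adj a x; set C := \sum_(x | _) adj c x.
  by move: A C #|nbrs a| #|nbrs c| => A C; clear; lia.
have nonempty (l : G) : 0 < #|nbrs l|.
  by apply: connected_deg => //; rewrite nG (leq_trans _ n5).
have in_cov l : l \notin [:: a; c] -> l \in nbrs a :|: nbrs c.
  move=> lN; have := nonempty l; rewrite deg_l // !inE.
  by case: (adj a l) (adj c l) => [] [].
have Nmid b : b \in nbrs a :&: nbrs c -> nbrs b = [set a; c].
  rewrite !inE => /andP[ab cb]; apply/eqP; rewrite eqEsubset.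
  rewrite Nl ?subUset ?sub1set ?inE 1?adj_sym ?ab 1?adj_sym //.
  by rewrite negb_or eq_sym adj_neq // eq_sym adj_neq.
have [ac|nac] := boolP (adj a c).
  have cov : nbrs a :|: nbrs c = setT.
    apply/setP=> u; rewrite [RHS]inE; have [|/in_cov //] := boolP (u \in [:: a; c]).
    by rewrite !inE => /orP[]/eqP->; rewrite ?ac // [adj c a]adj_sym ac orbT.
  have /eqP/cards1P[b common] : #|nbrs a :&: nbrs c| = 1.
    have := cardsUI (nbrs a) (nbrs c); rewrite cov cardsT degs ac nG.
    by clear; lia.
  have [ua|ua] := eqVneq (nbrs a) [set~ a]; first by constructor 1; exists a.
  have [uc|uc] := eqVneq (nbrs c) [set~ c]; first by constructor 1; exists c.
  have bB : b \in nbrs a :&: nbrs c by rewrite common inE.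
  constructor 3; apply: (adjacent_cover_bound (a := a) (c := c) (b := b)) => //.
  - move: bB; rewrite !inE => /andP[ab cb].
    by rewrite /= !inE negb_or aNc !adj_neq.
  - exact: Nmid.
  - by move=> l lN; apply: Nl; apply: contra lN; rewrite !inE orbA => ->.
have cov : nbrs a :|: nbrs c = ~: [set a; c].
  apply/setP=> u; rewrite [RHS]inE; have [|uN] := boolP (u \in [:: a; c]).
    rewrite !inE; case/orP=> /eqP->; rewrite eqxx ?orbT adj_irr.
      by rewrite adj_sym (negPf nac).
    by rewrite (negPf nac).
  by rewrite in_cov //; move: uN; rewrite !inE.
have /eqP/cards2P[b [d [bNd common]]] : #|nbrs a :&: nbrs c| = 2.
  have := cardsUI (nbrs a) (nbrs c); rewrite cov degs (negPf nac).
  have := cardsC [set a; c]; rewrite cards2 aNc nG.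
  by clear; lia.
have neq u : u \in nbrs a :&: nbrs c -> (a != u) /\ (c != u).
  by rewrite !inE => /andP[? ?]; rewrite !adj_neq.
have [bB dB] : b \in nbrs a :&: nbrs c /\ d \in nbrs a :&: nbrs c.
  by rewrite common set21 set22.
have [[ab cb] [ad cd]] := (neq b bB, neq d dB).
have [c2|c2] := leqP #|nbrs c| 2.
  constructor 2; exists a, b, c, d; apply: private_pendant_C4 => //.
  by rewrite /= !inE !negb_or ab aNc ad bNd cd eq_sym cb.
have [a2|a2] := leqP #|nbrs a| 2.
  constructor 2; exists c, b, a, d; apply: private_pendant_C4 => //.
  - by rewrite /= !inE !negb_or cb cd bNd ad eq_sym aNc eq_sym ab.
  - by rewrite setUC cov setUC.
  - by rewrite setIC.
  - by move=> l lN; rewrite setUC Nl //; move: lN; rewrite !inE orbC.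
constructor 3; apply: (nonadjacent_cover_bound (a := a) (c := c) (b := b) (d := d)) => //.
- by rewrite /= !inE !negb_or aNc ab ad cb cd bNd.
- exact: Nmid.
- exact: Nmid.
- by move=> l lN; apply: Nl; apply: contra lN; rewrite !inE !orbA => ->.
Qed.

Lemma nbrs_triangle (G : sgraph) (v x y z : G) :
    uniq [:: v; x; y; z] -> adj x y -> adj x z ->
    (forall p q : G, adj p q -> p != v -> q != v -> p \in [:: x; y; z]) ->
  nbrs x = if adj v x then [set v; y; z] else [set y; z].
Proof.
move=> U xy xz cover; apply/setP=> u; rewrite inE.
have [uv|uv] := eqVneq u v.
  subst u; rewrite adj_sym; case: (adj v x); rewrite !inE ?eqxx //.
  by move: U; rewrite /= !inE !negb_or => /andP[/and3P[_ /negPf-> /negPf->]].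
rewrite (fun_if (fun A : {set G} => u \in A)) !inE (negPf uv) /= if_same.
apply/idP/idP => [xu|/orP[]/eqP-> //].
have xv : x != v.
  by move: U; rewrite /= !inE !negb_or => /andP[/and3P[]]; rewrite eq_sym.
rewrite adj_sym in xu; have := cover u x xu uv xv.
by rewrite !inE (negPf (adj_neq xu)).
Qed.

(** Counting edges shows that exactly one vertex of the triangle is joined to [v]; rotating the
    triangle puts it first. *)
Lemma covered_star_triangle_bound (n : nat) (G : sgraph) :
    unicyclic G -> #|G| = n -> 5 <= n -> covered_star_triangle G ->
  6 * n ^ 2 < ecc_dist_sum G + 11 * n + 16.
Proof.
case/andP=> Gc /eqP cE nG n5 [v [x [y [z [U xy yz zx cover]]]]].
have perm_cover (s : seq G) : s =i [:: x; y; z] ->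
    forall p q : G, adj p q -> p != v -> q != v -> p \in s.
  by move=> sE p q pq pv qv; rewrite sE; apply: cover pq pv qv.
have [Uy Uz] : uniq [:: v; y; z; x] /\ uniq [:: v; z; x; y].
  have p1 : perm_eq [:: v; y; z; x] [:: v; x; y; z].
    by rewrite perm_cons -[[:: y; z; x]]/(rot 1 [:: x; y; z]) perm_rot.
  have p2 : perm_eq [:: v; z; x; y] [:: v; x; y; z].
    by rewrite perm_cons -[[:: z; x; y]]/(rot 2 [:: x; y; z]) perm_rot.
  by rewrite (perm_uniq p1) (perm_uniq p2).
have sy : [:: y; z; x] =i [:: x; y; z] by move=> u; rewrite !inE orbA orbC.
have sz : [:: z; x; y] =i [:: x; y; z] by move=> u; rewrite !inE orbC orbA.
have [yx zy xz] : [/\ adj y x, adj z y & adj x z].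
  by rewrite ![adj y x]adj_sym [adj z y]adj_sym [adj x z]adj_sym.
have Nx := nbrs_triangle U xy xz cover.
have Ny := nbrs_triangle Uy yz yx (@perm_cover [:: y; z; x] sy).
have Nz := nbrs_triangle Uz zx zy (@perm_cover [:: z; x; y] sz).
have Nl l : l \notin [:: v; x; y; z] -> nbrs l = [set v].
  rewrite in_cons negb_or => /andP[lv lN].
  have Ns : nbrs l \subset [set v].
    apply/subsetP=> u; rewrite !inE => lu; apply: contraNT lN => uv.
    exact: cover lu lv uv.
  apply/eqP; rewrite eqEcard Ns cards1 connected_deg //.
  by rewrite nG (leq_trans _ n5).
have cond_card (t u w : G) : uniq [:: v; t; u; w] ->
    #|(if adj v t then [set v; u; w] else [set u; w])| = adj v t + 2.
  move=> U'; have := U'; rewrite /= !inE !negb_or andbT.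
  case/andP=> /and3P[_ vu vw] /andP[_ uw]; case: (adj v t); rewrite ?cards2 ?uw //.
  by rewrite setUC cardsU1 cards2 !inE negb_or eq_sym vw vu eq_sym uw.
(* If k triangle vertices meet [v], the degrees sum to 2(n-4) + 2k + 6, which equals 2n only for k =
   1. *)
have degs : adj v x + adj v y + adj v z = 1.
  have := handshake G; rewrite -cE nG (sum_uniq_split _ U) !big_cons big_nil.
  rewrite (@sum_notin_eq _ _ _ 1 U); last by move=> l /Nl->; rewrite cards1.
  have := card_nbrs v; rewrite (sum_uniq_split _ U) !big_cons big_nil.
  rewrite (@sum_notin_eq _ _ _ 1 U); last first.
    by move=> l /Nl Nl1; rewrite adj_sym (nbrs_in _ Nl1) inE eqxx.
  move=> ->; rewrite Nx Ny Nz !cond_card // adj_irr nG /=.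
  by move: n5; clear; lia.
have [vx|vx] := boolP (adj v x).
  have [vy vz] : adj v y = false /\ adj v z = false.
    by move: degs; rewrite vx; case: (adj v y) (adj v z) => [] [].
  rewrite vx in Nx; rewrite vy in Ny; rewrite vz in Nz.
  by apply: (star_triangle_bound nG n5 U) => //; rewrite Ny setUC.
have [vy|vy] := boolP (adj v y).
  have vz : adj v z = false.
    by move: degs; rewrite vy; case: (adj v x) (adj v z) => [] [].
  rewrite (negPf vx) in Nx; rewrite vy in Ny; rewrite vz in Nz.
  apply: (star_triangle_bound nG n5 Uy) => //; first by rewrite Nz setUC.
  by move=> l; rewrite in_cons sy -in_cons; apply: Nl.
have vz : adj v z.
  by move: degs; rewrite (negPf vx) (negPf vy); case: (adj v z).
rewrite (negPf vx) in Nx; rewrite (negPf vy) in Ny; rewrite vz in Nz.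
apply: (star_triangle_bound nG n5 Uz) => //; first by rewrite Nx setUC.
by move=> l; rewrite in_cons sz -in_cons; apply: Nl.
Qed.

(** * Five vertices *)

(** The degrees sum to 10, so the total is 2(40 - 10). *)
Lemma sum_codeg5 (G : sgraph) : unicyclic G -> #|G| = 5 ->
  \sum_(v : G) 2 * (2 * #|G|.-1 - #|nbrs v|) = 60.
Proof.
case/andP=> _ /eqP cE G5; have hs := handshake G; rewrite -cE G5 in hs.
rewrite -big_distrr /= G5.
have : \sum_(v : G) (2 * 4 - #|nbrs v|) + \sum_(v : G) #|nbrs v| = 40.
  rewrite -big_split /= (eq_bigr (fun=> 8)) ?sum_nat_const ?G5 // => v _.
  by rewrite subnK // (leq_trans (max_card _)) // G5.
by rewrite hs => /(canRL (addnK _)) ->.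
Qed.

Lemma ecc_dist_sum5_ge (G : sgraph) : unicyclic G -> #|G| = 5 ->
    (forall v : G, nbrs v != [set~ v]) ->
  60 <= ecc_dist_sum G.
Proof.
move=> GU G5 nu; rewrite -(sum_codeg5 GU G5).
by apply: leq_sum => v _; apply: ecc_dist_ge2; rewrite ?G5.
Qed.

Lemma ecc_dist_sum5_eq (G : sgraph) : unicyclic G -> #|G| = 5 ->
    (forall v : G, nbrs v != [set~ v]) ->
  ecc_dist_sum G = 60 <-> forall v : G, far v = set0.
Proof.
move=> GU G5 nu; have G3 : 3 <= #|G| by rewrite G5.
split=> [xi v|f0]; last first.
  rewrite -(sum_codeg5 GU G5); apply: eq_bigr => v _.
  by rewrite ecc_dist_eq // f0 ?eqxx ?cards0 ?addn0 // => u; rewrite inE.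
apply/eqP; rewrite -cards_eq0 -leqn0 leqNgt; apply/negP=> fv.
suff : 60 < ecc_dist_sum G by rewrite xi.
rewrite -(sum_codeg5 GU G5) /ecc_dist_sum (bigD1 v) //= [X in _ < X](bigD1 v) //=.
(* A far vertex makes the term of [v] strictly larger: 3(9 - k) > 2(8 - k) for degree k <= 5. *)
rewrite -addSn; apply: leq_add; last first.
  by apply: leq_sum => u _; apply: ecc_dist_ge2.
apply: leq_trans (@ecc_dist_ge3 G v 1 G3 fv).
have : #|nbrs v| <= 5 by rewrite -G5 max_card.
by rewrite G5; move: #|nbrs v| => k; clear; lia.
Qed.

(* Diameter 2 forces minimum degree 2: the neighbour of a leaf would be
   adjacent to everything. *)
Lemma diam2_deg5 (G : sgraph) : unicyclic G -> #|G| = 5 ->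
    (forall v : G, nbrs v != [set~ v]) -> (forall v : G, far v = set0) ->
  forall v : G, #|nbrs v| = 2.
Proof.
move=> GU G5 nu f0; have [Gc /eqP cE] := andP GU.
have deg_ge2 (v : G) : 2 <= #|nbrs v|.
  have : 0 < #|nbrs v| by apply: connected_deg; rewrite ?G5.
  rewrite leq_eqVlt => /orP[|//]; rewrite eq_sym => /cards1P[w Nv].
  case/eqP: (nu w); apply/setP=> u; rewrite !inE.
  have [->|uw] := eqVneq u w; first by rewrite adj_irr.
  have [->|uv] := eqVneq u v; first by rewrite adj_sym (nbrs_in _ Nv) inE eqxx.
  apply: contraT => wu; suff : u \in far v by rewrite f0 inE.
  exact: far_pendant Nv uv uw wu.
(* The five degrees sum to 10 and are all at least 2, hence all equal 2. *)
have : \sum_(v : G) (#|nbrs v| - 2) = 0.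
  have hs := handshake G; rewrite -cE G5 in hs.
  have : \sum_(v : G) (#|nbrs v| - 2) + \sum_(v : G) 2 = \sum_(v : G) #|nbrs v|.
    by rewrite -big_split; apply: eq_bigr => v _; rewrite /= subnK.
  by rewrite hs sum_nat_const G5; move: (\sum_(_ | _) _) => S; clear; lia.
move/eqP; rewrite sum_nat_eq0 => /forallP h v.
by have := h v; have := deg_ge2 v; move: #|nbrs v| => k; clear; lia.
Qed.

(** The cycle is traced from [v0] in both directions; closing it too early, as a triangle or a
    4-cycle, would leave a vertex with no common neighbour with [v0]. *)
Lemma diam2_isom_C5 (G : sgraph) : #|G| = 5 ->
    (forall v : G, #|nbrs v| = 2) -> (forall v : G, far v = set0) ->
  isom G (cycle_graph 5).
Proof.
move=> G5 deg2 f0.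
have common (u v : G) : u != v -> ~~ adj v u -> exists2 w, adj v w & adj u w.
  move=> uv vu; have : u \notin far v by rewrite f0 inE.
  rewrite inE uv vu /= => /pred0Pn[w]; rewrite /= !inE => /andP[vw uw].
  by exists w.
have nbrs2 (v x y : G) : adj v x -> adj v y -> x != y -> nbrs v = [set x; y].
  move=> vx vy xy; apply/esym/eqP; rewrite eqEcard deg2 cards2 xy andbT.
  by rewrite subUset !sub1set !inE vx vy.
have other (v x : G) : adj v x -> exists2 y, adj v y & x != y.
  move=> vx; have : 0 < #|nbrs v :\ x|.
    by have := cardsD1 x (nbrs v); rewrite deg2 inE vx add1n => -[<-].
  by case/card_gt0P=> y; rewrite !inE eq_sym => /andP[? ?]; exists y.
have /card_gt0P[v0 _] : 0 < #|G| by rewrite G5.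
have /eqP/cards2P[v1 [v4 [v14 N0]]] := deg2 v0.
have [a01 a04] : adj v0 v1 /\ adj v0 v4.
  by rewrite !(nbrs_in _ N0) set21 set22.
have outside (s : seq G) : size s < 5 -> exists u, u \notin s.
  move=> s5; have : 0 < #|~: [set x in s]|.
    have := cardsC [set x in s]; rewrite G5 cardsE.
    by have := card_size s; move: #|_| #|_| s5 => k l; clear; lia.
  by case/card_gt0P=> u; rewrite in_setC in_set; exists u.
have n14 : ~~ adj v1 v4.
  apply/negP=> a14; have [u] := outside [:: v0; v1; v4] isT.
  rewrite !inE !negb_or => /and3P[u0 u1 u4].
  have N1 : nbrs v1 = [set v0; v4].
    by apply: nbrs2; [rewrite adj_sym | | apply: adj_neq].
  have N4 : nbrs v4 = [set v0; v1].
    by apply: nbrs2; rewrite 1?adj_sym //; apply: adj_neq.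
  have [|w] := common u v0 u0; first by rewrite (nbrs_in _ N0) !inE negb_or u1.
  rewrite (nbrs_in _ N0) in_set2 => /orP[]/eqP->; rewrite adj_sym.
    by rewrite (nbrs_in _ N1) !inE (negPf u0) (negPf u4).
  by rewrite (nbrs_in _ N4) !inE (negPf u0) (negPf u1).
have [v2 a12 v02] : exists2 y, adj v1 y & v0 != y by apply: other; rewrite adj_sym.
have [v3 a43 v03] : exists2 y, adj v4 y & v0 != y by apply: other; rewrite adj_sym.
have N1 : nbrs v1 = [set v0; v2] by apply: nbrs2; rewrite // adj_sym.
have N4 : nbrs v4 = [set v0; v3] by apply: nbrs2; rewrite // adj_sym.
have v24 : v2 != v4 by apply: contraNneq n14 => <-.
have v13 : v1 != v3 by apply: contraNneq n14 => ->; rewrite adj_sym.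
have v23 : v2 != v3.
  apply/eqP=> e; have [u] := outside [:: v0; v1; v4; v2] isT.
  rewrite !inE !negb_or => /and4P[u0 u1 u4 u2].
  have [|w] := common u v0 u0; first by rewrite (nbrs_in _ N0) !inE negb_or u1.
  rewrite (nbrs_in _ N0) in_set2 => /orP[]/eqP->; rewrite adj_sym.
    by rewrite (nbrs_in _ N1) !inE (negPf u0) (negPf u2).
  by rewrite (nbrs_in _ N4) !inE -e (negPf u0) (negPf u2).
pose t := [tuple v0; v1; v2; v3; v4].
have t_uniq : uniq t.
  rewrite /= !inE !negb_or v02 v03 v13 v14 v23 v24.
  by rewrite !adj_neq // adj_sym.
have t_inj : injective (tnth t) by apply/tuple_uniqP.
have t_bij : bijective (tnth t) by apply: inj_card_bij t_inj _; rewrite card_ord G5.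
have mem_t u : u \in [:: v0; v1; v2; v3; v4].
  by case: t_bij => f _ fK; rewrite -[u]fK; apply: mem_tnth.
(* The second neighbour of [v2] can only be [v3], because the neighbourhoods of [v0] and [v4] are
   already full. *)
have a23 : adj v2 v3.
  have [w a2w v1w] : exists2 y, adj v2 y & v1 != y by apply: other; rewrite adj_sym.
  have := mem_t w; rewrite !inE => /or4P[/eqP e|/eqP e|/eqP e|].
  - by move: a2w; rewrite e adj_sym (nbrs_in _ N0) !inE => /orP[]/eqP e2;
      move: a12 v24; rewrite e2 ?adj_irr ?eqxx.
  - by rewrite e eqxx in v1w.
  - by rewrite e adj_irr in a2w.
  case/orP=> /eqP e; first by rewrite -e.
  by move: a2w; rewrite e adj_sym (nbrs_in _ N4) !inE eq_sym (negPf v02) (negPf v23).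
have N2 : nbrs v2 = [set v1; v3] by apply: nbrs2; rewrite // adj_sym.
have N3 : nbrs v3 = [set v2; v4] by apply: nbrs2; rewrite // adj_sym.
have t_adj (i j : 'I_5) : adj (tnth t i) (tnth t j) = cycle_adj i j.
  have eqt (k l : 'I_5) : (tnth t k == tnth t l) = (k == l) by rewrite (inj_eq t_inj).
  have N (i0 k l : 'I_5) : nbrs (tnth t i0) = [set tnth t k; tnth t l] ->
      forall j0, adj (tnth t i0) (tnth t j0) = (j0 == k) || (j0 == l).
    by move=> Ni j0; rewrite (nbrs_in _ Ni) !inE !eqt.
  pose o k (k5 : k < 5) : 'I_5 := Ordinal k5.
  have E0 := N (@o 0 isT) (@o 1 isT) (@o 4 isT) N0.
  have E1 := N (@o 1 isT) (@o 0 isT) (@o 2 isT) N1.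
  have E2 := N (@o 2 isT) (@o 1 isT) (@o 3 isT) N2.
  have E3 := N (@o 3 isT) (@o 2 isT) (@o 4 isT) N3.
  have E4 := N (@o 4 isT) (@o 0 isT) (@o 3 isT) N4.
  case: i => [[|[|[|[|[|//]]]]] i5]; rewrite (bool_irrelevance i5 isT) ?E0 ?E1 ?E2 ?E3 ?E4;
    by case: j => [[|[|[|[|[|//]]]]] j5].
case: t_bij => f tK fK; exists f; first by exists (tnth t).
by move=> x y; rewrite -{2}(fK x) -{2}(fK y) t_adj.
Qed.

(** Any two distinct nonadjacent vertices of the 5-cycle have a common neighbour, found by
    enumeration and pulled back along the isomorphism. *)
Lemma isom_C5_diam2 (G : sgraph) :
  isom G (cycle_graph 5) -> forall v : G, far v = set0.
Proof.
case=> f [g fK gK] f_adj v; apply/eqP; rewrite -subset0; apply/subsetP=> u.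
rewrite !inE -f_adj -(inj_eq (can_inj fK)) => /and3P[uv vu].
suff [k vk uk] : exists2 k : cycle_graph 5, adj (f v) k & adj (f u) k.
  move/pred0P/(_ (g k)); rewrite /= !inE -[adj v _]f_adj -[adj u _]f_adj gK.
  by rewrite vk uk.
pose o k (k5 : k < 5) : cycle_graph 5 := Ordinal k5.
move: (f u) (f v) uv vu => [[|[|[|[|[|//]]]]] i5] [[|[|[|[|[|//]]]]] j5] // _ _;
  first [ by exists (@o 0 isT) | by exists (@o 1 isT) | by exists (@o 2 isT)
        | by exists (@o 3 isT) | by exists (@o 4 isT) ].
Qed.

(** * Assembling the cases for n = 5 and n >= 6 *)

Theorem theorem3p4 (n : nat) (G : sgraph) (n_ge5 : 5 <= n)
    (G_class : unicyclic_class n 2 G) (G_neqU : ~ isom G (U2_graph n)) :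
  (n = 5 ->
     60 <= ecc_dist_sum G /\
     (ecc_dist_sum G = 60 <-> isom G (cycle_graph 5))) /\
  (6 <= n ->
     6 * n ^ 2 - 11 * n - 16 <= ecc_dist_sum G /\
     (ecc_dist_sum G = 6 * n ^ 2 - 11 * n - 16 <-> isom G (@H_graph n 4 isT))).
Proof.
have /and3P[GU /eqP nG /eqP mG] := G_class; have [Gc _] := andP GU.
have nu (v : G) : nbrs v != [set~ v].
  apply/eqP=> /(universal_isom_U2 GU nG); rewrite (leq_trans _ n_ge5) // => /(_ isT).
  exact: G_neqU.
split=> [n5|n6].
  rewrite n5 in nG; split; first exact: ecc_dist_sum5_ge.
  apply: iff_trans (ecc_dist_sum5_eq GU nG nu) _; split=> [f0|].
    by apply: diam2_isom_C5 => //; apply: diam2_deg5.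
  exact: isom_C5_diam2.
have n4 : 4 <= n by apply: leq_trans n_ge5.
(* The left side is 11n + 16, so the subtraction in the claimed value does not truncate. *)
have big : 36 + 11 * (n - 6) + 46 <= 6 * n ^ 2.
  have [k ->] : exists k, n = k + 6 by exists (n - 6); rewrite subnK.
  by rewrite -mulnn; clear; lia.
have [[a [b [c [d P]]]]|lt] : (exists a b c d : G, pendant_C4 a b c d) \/
    6 * n ^ 2 < ecc_dist_sum G + 11 * n + 16.
  have [a [b [c [d [U ab cd]]]]] := matching2_pair mG.
  have G6 : 6 <= #|G| by rewrite nG.
  case: (no_3matching_cover Gc G6 (matching2_no3 mG) U ab cd).
    case/(covered2_cases GU nG n_ge5) => [[v /eqP]|?|?]; [|by left|by right].
    by rewrite (negPf (nu v)).
  by move/(covered_star_triangle_bound GU nG n_ge5); right.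
- have := pendant_C4_value nG n_ge5 P => xi.
  split; first by rewrite -xi; clear; lia.
  split=> _; last by rewrite -xi; clear; lia.
  by apply/(pendant_C4_isom nG n4); exists a, b, c, d.
(* Here the bound is strict, which rules out both the extremal value and, through the value of
   [pendant_C4], an isomorphism with H_{n,4}. *)
- split; first by move: lt; clear; lia.
  split=> [xi|/(pendant_C4_isom nG n4)[a [b [c [d P]]]]].
    by exfalso; move: lt big; rewrite xi; move: (n ^ 2) n6 => N; clear; lia.
  by rewrite -(pendant_C4_value nG n_ge5 P) ltnn in lt.
Qed.
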